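(* Let $d\ge2$. The map $\mathcal{A}\mapsto(\Delta_{\mathcal{A}},r_{\mathcal{A}})$, sending an irreducible Euclidean $\vee$-system $\mathcal{A}=\{\alpha_i\}_{i=1}^n\subset\mathbb{R}^d$ to the weighted arrangement with $\Delta_{\mathcal{A}}=\{\alpha_1^\perp,\dots,\alpha_n^\perp\}$ and $r_{\mathcal{A}}=(|\alpha_1|^2,\dots,|\alpha_n|^2)$, defines a bijection between irreducible Euclidean $\vee$-systems in $\mathbb{R}^d$ up to orthogonal projective equivalence and real PK arrangements in $\mathbb{R}^d$ up to linear equivalence.
   Context: $\mathbb{R}^d$ carries its standard Euclidean inner product $(\cdot,\cdot)$. Euclidean $\vee$-system in $\mathbb{R}^d$: a finite set $\mathcal{A}=\{\alpha_1,\dots,\alpha_n\}\subset\mathbb{R}^d\setminus\{0\}$ of pairwise non-proportional vectors such that: (V1) $\sum_{i=1}^n (x,\alpha_i)^2=|x|^2$ for all $x\in\mathbb{R}^d$; (V2) for every linear $2$-plane $\Pi\subset\mathbb{R}^d$ with $|\mathcal{A}\cap\Pi|\ge 3$ there is $\nu(\Pi)\in\mathbb{R}$ with $\sum_{i:\alpha_i\in\Pi}(x,\alpha_i)^2=\nu(\Pi)|x|^2$ for all $x\in\Pi$; (V3) for every linear $2$-plane $\Pi\subset\mathbb{R}^d$ with $\mathcal{A}\cap\Pi=\{\alpha_i,\alpha_j\}$ for some $i\ne j$, one has $(\alpha_i,\alpha_j)=0$. $\mathcal{A}$ is reducible if there is a non-trivial direct sum decomposition $\mathbb{R}^d=P\oplus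 P'$ into linear subspaces with $\mathcal{A}=(\mathcal{A}\cap P)\cup(\mathcal{A}\cap P')$; it is irreducible if it is not reducible. Hirzebruch quadratic form: for a finite set $\mathcal{H}=\{H_1,\dots,H_n\}$ of pairwise distinct linear hyperplanes in $\mathbb{R}^d$, let $\mathcal{G}$ be the set of codimension-$2$ linear subspaces $S\subset\mathbb{R}^d$ that are the common intersection of $3$ or more hyperplanes in $\mathcal{H}$; let $w_S=\frac12\sum_{i:S\subset H_i}w_i$ for $S\in\mathcal{G}$; and let $\sigma_i$ be the number of $S\in\mathcal{G}$ with $S\subset H_i$. The Hirzebruch quadratic form of $\mathcal{H}$ is $$Q(w_1,\dots,w_n)=\sum_{S\in\mathcal{G}}w_S^2-\frac12\sum_{i=1}^n(\sigma_i-1)w_i^2-\frac1{2d}\Big(\sum_{i=1}^n w_i\Big)^2 .$$ Real PK arrangement in $\mathbb{R}^d$ ($d\ge2$): a pair $(\mathcal{H},w)$ with $\mathcal{H}=\{H_1,\dots,H_n\}$ a finite set of pairwise distinct linear hyperplanes in $\mathbb{R}^d$ and $w=(w_1,\dots,w_n)$ with $w_i\in(0,1)$ for all $i$, such that: (PK1) $\sum_{i=1}^n w_i=d$; (PK2) for every non-zero proper linear subspace $L\subset\mathbb{R}^d$ obtained as an intersection of hyperplanes in $\mathcal{H}$, $\sum_{i:L\subset H_i}w_i<d-\dim L$; (PK3) $Q(w_1,\dots,w_n)=0$, where $Q$ is the Hirzebruch quadratic form of $\mathcal{H}$. Orthogonal projective equivalence: $\{\alpha_i\}_{i=1}^n$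 and $\{\beta_i\}_{i=1}^n$ in $\mathbb{R}^d$ are orthogonal projectively equivalent if there is a linear isometry $G\in\mathrm{O}(d)$ with $\beta_i=\pm G(\alpha_i)$ for all $i$. Linear equivalence: two arrangements of linear hyperplanes $\{H_i\}_{i=1}^n$ and $\{H_i'\}_{i=1}^n$ in $\mathbb{R}^d$ are linearly equivalent if there is an invertible linear transformation $F\in\mathrm{GL}(d)$ with $H_i'=F(H_i)$ for all $i$. Two weighted arrangements (hyperplane arrangements with a weight vector) are linearly equivalent if their corresponding hyperplane arrangements are.
   Formalization: Linear equivalence of weighted arrangements is taken to require equal weights as well as linearly equivalent hyperplanes; ignoring the weights, injectivity fails for three lines in the plane. *)

(* Defs.v *)
From HB Require Import structures.
From mathcomp Require Import all_boot all_order all_algebra.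
From mathcomp Require Import boolp classical_sets functions reals.

Set Implicit Arguments.
Unset Strict Implicit.
Unset Printing Implicit Defensive.

Import Order.TTheory GRing.Theory Num.Theory.

Local Open Scope ring_scope.

Definition inner (R : realType) (d : nat) (x y : 'rV[R]_d) : R :=
  (x *m y^T) 0 0.

Definition sqnorm (R : realType) (d : nat) (x : 'rV[R]_d) : R := inner x x.

Definition perp (R : realType) (d : nat) (a : 'rV[R]_d) : {vspace 'rV[R]_d} :=
  lker (linfun (mulmxr a^T : 'rV[R]_d -> 'M[R]_1)).

Lemma mem_perp (R : realType) (d : nat) (a x : 'rV[R]_d) :
  (x \in perp a) = (inner x a == 0).
Proof.
rewrite memv_ker lfunE /= /inner; apply/eqP/eqP => [-> | h].
  by rewrite mxE.
by apply/matrixP => i j; rewrite !ord1 h mxE.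
Qed.

(* Finite sets of vectors and of hyperplanes are labelled by 'I_n, as required
   by the two equivalence relations, which compare members label by label. *)

Definition in_plane (R : realType) (d n : nat) (a : 'I_n -> 'rV[R]_d)
    (P : {vspace 'rV[R]_d}) : {set 'I_n} :=
  [set i | a i \in P].

Record vee_system (R : realType) (d n : nat) (a : 'I_n -> 'rV[R]_d) : Prop :=
  VeeSystem {
    vee_neq0 : forall i, a i != 0;
    vee_nonprop : forall i j, i != j -> a i \notin <[a j]>%VS;
    vee_V1 : forall x, \sum_i inner x (a i) ^+ 2 = sqnorm x;
    vee_V2 : forall P : {vspace 'rV[R]_d}, \dim P = 2 ->
      (3 <= #|in_plane a P|)%N ->
      exists nu : R, forall x, x \in P ->
        \sum_(i in in_plane a P) inner x (a i) ^+ 2 = nu * sqnorm x;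
    vee_V3 : forall P : {vspace 'rV[R]_d}, \dim P = 2 ->
      forall i j, i != j -> in_plane a P = [set i; j] -> inner (a i) (a j) = 0
  }.

Definition reducible (R : realType) (d n : nat) (a : 'I_n -> 'rV[R]_d) : Prop :=
  exists P P' : {vspace 'rV[R]_d},
    [/\ P != 0%VS, P' != 0%VS, directv (P + P'), (P + P')%VS = fullv
      & forall i, (a i \in P) || (a i \in P')].

Definition irreducible_vee_system (R : realType) (d n : nat)
    (a : 'I_n -> 'rV[R]_d) : Prop :=
  vee_system a /\ ~ reducible a.

Definition orth_proj_equiv (R : realType) (d n : nat)
    (a b : 'I_n -> 'rV[R]_d) : Prop :=
  exists2 G : 'End('rV[R]_d), forall x, sqnorm (G x) = sqnorm x
    & forall i, b i = G (a i) \/ b i = - G (a i).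

Record warrangement (R : realType) (d n : nat) := WArrangement {
  hyp : 'I_n -> {vspace 'rV[R]_d};
  wt : 'I_n -> R
}.

Definition inter_hyp (R : realType) (d n : nat)
    (H : 'I_n -> {vspace 'rV[R]_d}) (J : {set 'I_n}) : {vspace 'rV[R]_d} :=
  (\bigcap_(i in J) H i)%VS.

(* The set G of codimension-2 subspaces, as a duplicate-free sequence.  For
   pairwise distinct H i, the bound on #|J| asks for three hyperplanes. *)
Definition codim2 (R : realType) (d n : nat) (H : 'I_n -> {vspace 'rV[R]_d}) :
    seq {vspace 'rV[R]_d} :=
  let Js := [set J : {set 'I_n} | (3 <= #|J|)%N] in
  undup [seq S <- [seq inter_hyp H J | J <- enum Js] | (\dim S + 2)%N == d].

Definition hirzebruch_form (R : realType) (d n : nat)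
    (H : 'I_n -> {vspace 'rV[R]_d}) (w : 'I_n -> R) : R :=
  let wS S := 2^-1 * \sum_(i | (S <= H i)%VS) w i in
  let sigma i := count (fun S => (S <= H i)%VS) (codim2 H) in
  \sum_(S <- codim2 H) wS S ^+ 2
  - 2^-1 * \sum_i ((sigma i)%:R - 1) * w i ^+ 2
  - (2 * d%:R)^-1 * (\sum_i w i) ^+ 2.

Record PK_arrangement (R : realType) (d n : nat) (X : warrangement R d n) :
    Prop := PKArrangement {
  PK_hyperplane : forall i, (\dim (hyp X i) + 1)%N = d;
  PK_distinct : injective (hyp X);
  PK_weight : forall i, 0 < wt X i < 1;
  PK_PK1 : \sum_i wt X i = d%:R;
  PK_PK2 : forall J : {set 'I_n}, let L := inter_hyp (hyp X) J in
    L != 0%VS -> L != fullv ->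
    \sum_(i | (L <= hyp X i)%VS) wt X i < d%:R - (\dim L)%:R;
  PK_PK3 : hirzebruch_form (hyp X) (wt X) = 0
}.

(* Equivalent weighted arrangements have the same weights.  Comparing only the
   hyperplanes would identify all weighted arrangements of three lines in R^2,
   whereas the norms of the vectors are orthogonal invariants. *)
Definition lin_equiv (R : realType) (d n : nat) (X Y : warrangement R d n) :
    Prop :=
  (exists2 F : 'End('rV[R]_d), lker F == 0%VS
     & forall i, hyp Y i = (F @: hyp X i)%VS)
  /\ forall i, wt Y i = wt X i.

Definition eq_class (T : Type) (D : set T) (e : T -> T -> Prop) (x : T) :
    set T :=
  [set y | D y /\ e x y]%classic.

Definition eq_classes (T : Type) (D : set T) (e : T -> T -> Prop) :
    set (set T) :=
  (eq_class D e @` D)%classic.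

Definition arrangement_of (R : realType) (d n : nat) (a : 'I_n -> 'rV[R]_d) :
    warrangement R d n :=
  WArrangement (fun i => perp (a i)) (fun i => sqnorm (a i)).

(* Main.v *)
Require Import Defs.
From HB Require Import structures.
From mathcomp Require Import all_boot all_order all_algebra.
From mathcomp Require Import boolp classical_sets functions reals.
From mathcomp Require Import topology normedtype sequences derive exp.
From mathcomp Require Import ring lra zify.

(** Condition [vee_V1] says that the vectors form a tight frame: the sum of the
    rank-one forms (x, a_i)^2 is |x|^2.  Put w_i = |a_i|^2.  The proof separates
    what is true of every tight frame from the problem of making a given
    arrangement tight.

    For a tight frame, the traces of the identity and of its square give
    sum_i w_i = d and sum_(i, j) (a_i, a_j)^2 = d.  Sorting the pairs (i, j) by
    the plane that they span turns the second equation into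
    [hirzebruch_formE]: -2 Q(w) is the sum, over the planes P with at least
    three vectors, of tr M_P^2 - (tr M_P)^2 / 2, where M_P is the partial frame
    operator on P, plus the sum of (a_i, a_j)^2 over the pairs that span any
    other plane.  Every term is nonnegative; the first kind vanishes when M_P
    is scalar, which is [vee_V2], and the second kind when [vee_V3] holds.
    Hence a tight frame is a vee-system exactly when Q(w) = 0
    ([hirzebruch_vee]).  Similarly, projecting the frame to a flat L shows that
    the stability inequality [PK_PK2] at L can only become an equality when L
    and its orthogonal complement split the frame, so [PK_PK2] matches
    irreducibility ([tight_stable], [PK_vee]).

    There remains a statement about weighted arrangements that satisfy
    [PK_PK1] and [PK_PK2]: up to isometry and signs there is exactly one tight
    frame with |a_i|^2 = w_i whose orthogonal hyperplanes form a linear image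
    of the arrangement.

    Existence ([radial_isotropic]): let v_i be normal vectors of the
    hyperplanes, and minimize det (sum_i e^(t_i) v_i^T v_i) e^(- sum_i w_i t_i)
    over t in R^n.  Stability makes this function coercive modulo the
    translations that leave it invariant ([potential_coercive]): the determinant
    is bounded below, up to a constant, by the product of the e^(t_i) over a
    basis chosen greedily by decreasing t_i, and [PK_PK2] says that a greedy
    basis collects more than its share of weight at every stage.  At a minimum,
    M = sum_i e^(t_i) v_i^T v_i satisfies e^(t_i) v_i M^-1 v_i^T = w_i, so that
    the vectors e^(t_i / 2) v_i M^(-1/2) form the required frame; a Cholesky
    factor of M serves as the square root.

    Uniqueness ([tight_rigid]): if b_i = k_i a_i A are two tight frames with the
    same norms, comparing them on the top eigenspace E of A A^T forces each a_i
    to lie in E or in its orthogonal complement.  By irreducibility E is the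
    whole space, and A is a multiple of an isometry. *)

Set Implicit Arguments.
Unset Strict Implicit.
Unset Printing Implicit Defensive.

Import Order.TTheory GRing.Theory Num.Theory.
Import numFieldNormedType.Exports.

Local Open Scope ring_scope.

(** * Inner product, Cholesky factorization and orthogonal complements *)

Section InnerProduct.
Variables (R : realType) (d : nat).
Implicit Types (x y z : 'rV[R]_d) (W : {vspace 'rV[R]_d}).

Lemma innerE x y : inner x y = \sum_k x 0 k * y 0 k.
Proof. by rewrite /inner mxE; apply: eq_bigr => k _; rewrite mxE. Qed.

Lemma innerC x y : inner x y = inner y x.
Proof. by rewrite !innerE; apply: eq_bigr => k _; rewrite mulrC. Qed.

Lemma innerDl x y z : inner (x + y) z = inner x z + inner y z.
Proof. by rewrite /inner mulmxDl mxE. Qed.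

Lemma innerZl c x y : inner (c *: x) y = c * inner x y.
Proof. by rewrite /inner -scalemxAl mxE. Qed.

Lemma inner0l x : inner 0 x = 0.
Proof. by rewrite /inner mul0mx mxE. Qed.

Lemma innerNl x y : inner (- x) y = - inner x y.
Proof. by rewrite -scaleN1r innerZl mulN1r. Qed.

Lemma innerDr x y z : inner z (x + y) = inner z x + inner z y.
Proof. by rewrite innerC innerDl !(innerC z). Qed.

Lemma innerZr c x y : inner y (c *: x) = c * inner y x.
Proof. by rewrite innerC innerZl innerC. Qed.

Lemma inner0r x : inner x 0 = 0.
Proof. by rewrite innerC inner0l. Qed.

Lemma innerNr x y : inner y (- x) = - inner y x.
Proof. by rewrite innerC innerNl innerC. Qed.

Lemma inner_suml (I : finType) (F : I -> 'rV[R]_d) y :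
  inner (\sum_i F i) y = \sum_i inner (F i) y.
Proof. by rewrite /inner mulmx_suml summxE. Qed.

Lemma inner_mulmx x k (A : 'M[R]_(d, k)) (y : 'rV[R]_k) :
  inner (x *m A) y = inner x (y *m A^T).
Proof. by rewrite /inner trmx_mul trmxK mulmxA. Qed.

Lemma sqnorm_ge0 x : 0 <= sqnorm x.
Proof. by rewrite /sqnorm innerE sumr_ge0// => k _; rewrite -expr2 sqr_ge0. Qed.

Lemma sqnorm_eq0 x : (sqnorm x == 0) = (x == 0).
Proof.
apply/eqP/eqP => [|->]; last by rewrite /sqnorm inner0l.
rewrite /sqnorm innerE => /eqP; rewrite psumr_eq0; last first.
  by move=> k _; rewrite -expr2 sqr_ge0.
move=> /allP h; apply/rowP => k; rewrite mxE.
have := h k; rewrite mem_index_enum => /(_ isT) /=.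
by rewrite mulf_eq0 orbb => /eqP.
Qed.

Lemma sqnorm_gt0 x : (0 < sqnorm x) = (x != 0).
Proof. by rewrite lt_def sqnorm_ge0 andbT sqnorm_eq0. Qed.

Lemma sqnormZ c x : sqnorm (c *: x) = c ^+ 2 * sqnorm x.
Proof. by rewrite /sqnorm innerZl innerZr mulrA expr2. Qed.

Lemma sqnormN x : sqnorm (- x) = sqnorm x.
Proof. by rewrite /sqnorm innerNl innerNr opprK. Qed.

Lemma sqnormD x y : sqnorm (x + y) = sqnorm x + 2 * inner x y + sqnorm y.
Proof. by rewrite /sqnorm !innerDl !innerDr (innerC y x); ring. Qed.

Lemma inner_delta x k : inner x (delta_mx 0 k) = x 0 k.
Proof.
rewrite innerE (bigD1 k)//= mxE !eqxx mulr1 big1 ?addr0// => j /negbTE nj.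
by rewrite mxE nj andbF mulr0.
Qed.

End InnerProduct.

Section Cholesky.
Variable R : realType.

Lemma inner11 (u v : 'rV[R]_1) : inner u v = u 0 0 * v 0 0.
Proof. by rewrite innerE big_ord1. Qed.

Lemma inner_row_mx m k (u u' : 'rV[R]_m) (y y' : 'rV[R]_k) :
  inner (row_mx u y) (row_mx u' y') = inner u u' + inner y y'.
Proof.
rewrite !innerE big_split_ord /=.
by congr (_ + _); apply: eq_bigr => i _; rewrite ?row_mxEl ?row_mxEr.
Qed.

Definition posdef k (M : 'M[R]_k) :=
  M^T = M /\ forall x : 'rV[R]_k, x != 0 -> 0 < inner (x *m M) x.

(** Induction on the size: the Schur complement of the top left entry is again
    positive definite, because its value at [y] is the value of [M] at [y]
    completed by the first coordinate that minimizes the form. *)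
Lemma cholesky k (M : 'M[R]_k) :
  posdef M -> exists2 C : 'M[R]_k, C \in unitmx & M = C^T *m C.
Proof.
elim: k M => [|k IH] M [Msym Mpos].
  by exists 1%:M; rewrite ?unitmx1//; apply/matrixP => -[].
rewrite -[k.+1]/(1 + k)%N in M Msym Mpos *.
pose a := ulsubmx M 0 0; pose b := ursubmx M; pose D := drsubmx M.
have Mblk : M = block_mx a%:M b b^T D.
  rewrite -[LHS]submxK [ulsubmx M]mx11_scalar; congr block_mx.
  by rewrite /b trmx_ursub Msym.
have Dsym : D^T = D by rewrite /D trmx_drsub Msym.
have blockE (u : 'rV[R]_1) (y : 'rV[R]_k) :
    inner (row_mx u y *m M) (row_mx u y) =
    a * u 0 0 ^+ 2 + 2 * u 0 0 * inner b y + inner (y *m D) y.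
  rewrite Mblk (mul_row_block u y) inner_row_mx !innerDl !inner11.
  have ub : u *m b = u 0 0 *: b by rewrite [u]mx11_scalar mul_scalar_mx !mxE eqxx.
  by rewrite ub innerZl mul_mx_scalar mxE -[(y *m _) 0 0]/(inner y b) innerC; ring.
have a_gt0 : 0 < a.
  have /Mpos : row_mx (1%:M : 'rV[R]_1) (0 : 'rV[R]_k) != 0.
    rewrite row_mx_eq0 negb_and; apply/orP; left.
    by apply/eqP => /matrixP/(_ 0 0)/eqP; rewrite !mxE eqxx oner_eq0.
  rewrite blockE inner0r mul0mx inner0l [1%:M 0 0]mxE eqxx mulr1n; lra.
pose S := D - a^-1 *: (b^T *m b).
have Spos : posdef S.
  split.
    by rewrite /S linearB linearZ /= Dsym trmx_mul trmxK.
  move=> y y0.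
  (* The first coordinate minimizes the form of [M] on the line above [y]. *)
  have /Mpos : row_mx ((- (inner b y / a))%:M : 'rV[R]_1) y != 0.
    by rewrite row_mx_eq0 negb_and y0 orbT.
  rewrite blockE !mxE eqxx mulr1n /S mulmxBr innerDl innerNl.
  rewrite -scalemxAr innerZl mulmxA [inner (_ *m b) y]inner_mulmx inner11.
  rewrite -[(y *m b^T) 0 0]/(inner y b).
  rewrite (innerC y b); set q := inner b y; set p := inner _ _.
  move=> h; suff <- : a * (- (q / a)) ^+ 2 + 2 * - (q / a) * q + p =
     p - a^-1 * (q * q) by [].
  by field; rewrite gt_eqF.
have [C1 C1u SC] := IH _ Spos.
have sa : Num.sqrt a != 0 by rewrite gt_eqF// sqrtr_gt0.
exists (block_mx (Num.sqrt a)%:M ((Num.sqrt a)^-1 *: b) 0 C1).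
  by rewrite unitmxE det_ublock det_scalar1 unitrM -unitmxE C1u andbT unitfE.
rewrite Mblk tr_block_mx mulmx_block !trmx0 !mul0mx !addr0 mulmx0.
rewrite tr_scalar_mx -scalar_mxM -expr2 sqr_sqrtr ?(ltW a_gt0)//.
rewrite mul_scalar_mx scalerA divff// scale1r; congr block_mx.
  by rewrite addr0 mul_mx_scalar linearZ /= scalerA divff// scale1r.
rewrite [(_ *: b)^T]linearZ /= -scalemxAl -scalemxAr scalerA -invfM -expr2.
by rewrite sqr_sqrtr ?(ltW a_gt0)// -SC /S addrC subrK.
Qed.

End Cholesky.

Section OrthogonalComplement.
Variables (R : realType) (d : nat).
Implicit Types (x y z : 'rV[R]_d) (W : {vspace 'rV[R]_d}).

Lemma row_combination k (X : 'I_k -> 'rV[R]_d) (u : 'rV[R]_k) :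
  u *m \matrix_i X i = \sum_i u 0 i *: X i.
Proof. by rewrite mulmx_sum_row; apply: eq_bigr => i _; rewrite rowK. Qed.

(** A Cholesky factor of the Gram matrix of a basis orthonormalizes the basis;
    [B^T *m B] is then the orthogonal projection to [W]. *)
Lemma orthonormal_basis W : exists B : 'M[R]_(\dim W, d),
  B *m B^T = 1%:M /\ forall x, (x \in W) = (x == x *m B^T *m B).
Proof.
pose B0 : 'M[R]_(\dim W, d) := \matrix_i (vbasis W)`_i.
have B0in (u : 'rV_(\dim W)) : u *m B0 \in W.
  rewrite row_combination rpred_sum// => i _; rewrite rpredZ//.
  by apply: vbasis_mem; rewrite mem_nth// size_tuple.
have B0P x : x \in W -> exists u, x = u *m B0.
  move=> xW; exists (\row_i coord (vbasis W) i x).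
  rewrite row_combination [LHS](coord_vbasis xW).
  by apply: eq_bigr => i _; rewrite mxE.
have B0free (u : 'rV_(\dim W)) : u *m B0 = 0 -> u = 0.
  rewrite row_combination => u0; apply/rowP => i; rewrite mxE.
  by have /freeP/(_ (u 0) u0 i) := basis_free (vbasisP W).
have [|C Cu GC] := @cholesky _ _ (B0 *m B0^T).
  split=> [|u u0]; first by rewrite trmx_mul trmxK.
  rewrite mulmxA inner_mulmx trmxK -/(sqnorm _) sqnorm_gt0.
  by apply: contra_neq u0; apply: B0free.
have CTu : C^T \in unitmx by rewrite unitmx_tr.
have BB : invmx C^T *m B0 *m (invmx C^T *m B0)^T = 1%:M.
  rewrite trmx_mul mulmxA -(mulmxA _ B0) GC mulmxA mulVmx// mul1mx.
  by rewrite trmx_inv trmxK mulmxV.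
exists (invmx C^T *m B0); split=> // x.
apply/idP/eqP => [/B0P[u ->]|->]; last by rewrite mulmxA B0in.
have -> : u *m B0 = u *m C^T *m (invmx C^T *m B0).
  by rewrite !mulmxA mulmxK.
by rewrite -[_ *m _ *m _^T]mulmxA BB mulmx1.
Qed.

Definition orthc W : {vspace 'rV[R]_d} :=
  (\bigcap_(i < \dim W) perp (vbasis W)`_i)%VS.

Lemma orthcP W x : reflect {in W, forall y, inner x y = 0} (x \in orthc W).
Proof.
apply: (iffP idP) => [xW y yW|h].
  rewrite (coord_vbasis yW) innerC inner_suml big1// => i _; rewrite innerZl.
  by move: xW => /subv_bigcapP/(_ i isT); rewrite -memvE mem_perp innerC => /eqP->;
    rewrite mulr0.
rewrite memvE; apply/subv_bigcapP => i _; rewrite -memvE mem_perp h//.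
by apply: vbasis_mem; rewrite mem_nth// size_tuple.
Qed.

Lemma cap_orthc W : (W :&: orthc W = 0)%VS.
Proof.
apply/eqP; rewrite -subv0; apply/subvP => x; rewrite memv_cap memv0.
by case/andP => xW /orthcP/(_ x xW)/eqP; rewrite -/(sqnorm x) sqnorm_eq0.
Qed.

Lemma add_orthc W : (W + orthc W = fullv)%VS.
Proof.
apply/eqP; rewrite eqEsubv subvf /=; apply/subvP => x _.
have [B [BB BW]] := orthonormal_basis W.
rewrite -[x](subrK (x *m B^T *m B)) addrC memv_add//.
  by rewrite BW -!mulmxA (mulmxA B) BB mul1mx.
apply/orthcP => y; rewrite BW => /eqP ->.
by rewrite innerC inner_mulmx mulmxBl -!mulmxA BB mulmx1 subrr inner0r.
Qed.

Lemma directv_orthc W : directv (W + orthc W).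
Proof. by apply/directv_addP; exact: cap_orthc. Qed.

Lemma dim_orthc W : (\dim W + \dim (orthc W))%N = d.
Proof.
rewrite -dimv_disjoint_sum ?cap_orthc// add_orthc dimvf.
by rewrite /dim /= mul1n.
Qed.

Lemma orthcK W : orthc (orthc W) = W.
Proof.
apply/esym/eqP; rewrite eqEdim -(leq_add2l (\dim (orthc W))) dim_orthc.
rewrite addnC dim_orthc leqnn andbT; apply/subvP => x xW.
by apply/orthcP => y /orthcP/(_ x xW); rewrite innerC.
Qed.

Lemma orthcS W W' : (W <= W')%VS -> (orthc W' <= orthc W)%VS.
Proof.
move=> WW'; apply/subvP => x /orthcP h; apply/orthcP => y yW.
by rewrite h// (subvP WW').
Qed.

Lemma perpE x : perp x = orthc <[x]>%VS.
Proof.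
apply/vspaceP => y; rewrite mem_perp; apply/eqP/orthcP => [h z /vlineP[k ->]|->//].
  by rewrite innerZr h mulr0.
exact: memv_line.
Qed.

Lemma orthc_perp x : orthc (perp x) = <[x]>%VS.
Proof. by rewrite perpE orthcK. Qed.

Lemma sub_perp W x : (W <= perp x)%VS = (x \in orthc W).
Proof.
apply/idP/orthcP => [/subvP h y /h|h]; first by rewrite mem_perp innerC => /eqP.
by apply/subvP => y /h; rewrite mem_perp innerC => ->.
Qed.

Lemma hyperplane_perp W : (\dim W + 1)%N = d -> exists2 v, v != 0 & W = perp v.
Proof.
move=> dW; have dW' : \dim (orthc W) = 1%N.
  by apply/eqP; rewrite -(eqn_add2l (\dim W)) dim_orthc dW.
have v0 : vpick (orthc W) != 0 by rewrite vpick0 -dimv_eq0 dW'.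
exists (vpick (orthc W)) => //; rewrite -[LHS]orthcK perpE; congr orthc.
apply/eqP; rewrite eq_sym eqEdim dW' dim_vline v0 andbT -memvE.
exact: memv_pick.
Qed.

Lemma dim_perp x : x != 0 -> (\dim (perp x) + 1)%N = d.
Proof. by move=> x0; rewrite -[RHS](dim_orthc <[x]>) dim_vline x0 -perpE addnC. Qed.

End OrthogonalComplement.

(** * Tight frames *)

Section TightFrames.
Variables (R : realType) (d n : nat).
Implicit Types (a : 'I_n -> 'rV[R]_d) (L W P : {vspace 'rV[R]_d}).

Definition tight a := forall x, \sum_i inner x (a i) ^+ 2 = sqnorm x.

Lemma mulmx_tr_inner k (B : 'M[R]_(k, d)) (x : 'rV[R]_d) r :
  (x *m B^T) 0 r = inner x (row r B).
Proof. by rewrite innerE mxE; apply: eq_bigr => j _; rewrite !mxE. Qed.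

Lemma sqnormE k (x : 'rV[R]_k) : sqnorm x = \sum_r x 0 r ^+ 2.
Proof. by rewrite /sqnorm innerE; apply: eq_bigr => r _; rewrite expr2. Qed.

(** Both sides are the trace of [B] S [B^T], where S is the frame operator, that
    is the identity. *)
Lemma tight_trace a k (B : 'M[R]_(k, d)) : tight a ->
  \sum_i sqnorm (a i *m B^T) = \sum_r sqnorm (row r B).
Proof.
move=> ta; under eq_bigr do rewrite sqnormE.
rewrite exchange_big /=; apply: eq_bigr => r _; rewrite -ta.
by apply: eq_bigr => i _; rewrite mulmx_tr_inner innerC.
Qed.

Lemma orthonormal_row k (B : 'M[R]_(k, d)) r :
  B *m B^T = 1%:M -> sqnorm (row r B) = 1.
Proof.
move=> /matrixP/(_ r r); rewrite [RHS]mxE eqxx mulr1n => <-.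
by rewrite /sqnorm innerE mxE; apply: eq_bigr => j _; rewrite !mxE.
Qed.

Lemma tight_orthonormal a k (B : 'M[R]_(k, d)) :
  tight a -> B *m B^T = 1%:M -> \sum_i sqnorm (a i *m B^T) = k%:R.
Proof.
move=> ta BB; rewrite tight_trace//; under eq_bigr do rewrite orthonormal_row//.
by rewrite big_const_ord iter_addr_0.
Qed.

Lemma tight_sum a : tight a -> \sum_i sqnorm (a i) = d%:R.
Proof.
move=> ta; have := @tight_orthonormal a d 1%:M ta; rewrite trmx1 mul1mx => <-//.
by apply: eq_bigr => i _; rewrite mulmx1.
Qed.

Lemma sqnorm_orthonormal k (B : 'M[R]_(k, d)) (x : 'rV[R]_d) :
  B *m B^T = 1%:M ->
  sqnorm x = sqnorm (x *m B^T) + sqnorm (x - x *m B^T *m B).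
Proof.
move=> BB; rewrite [in RHS]sqnormD sqnormN innerNr.
rewrite [sqnorm (_ *m B)]/sqnorm inner_mulmx -[_ *m B *m _]mulmxA BB mulmx1.
by rewrite (innerC x) inner_mulmx /sqnorm; ring.
Qed.

(** Let B project to L.  The squared norms of the a_i add up to d and those of
    their projections to dim L, so the difference of the two sides is the sum of
    |a_i|^2 - |a_i B^T|^2 over the vectors that are not orthogonal to L.  If it
    vanished, all these vectors would lie in L, and the frame would split. *)
Lemma tight_stable a L : tight a -> ~ reducible a -> L != 0%VS -> L != fullv ->
  \sum_(i | a i \in orthc L) sqnorm (a i) < d%:R - (\dim L)%:R.
Proof.
move=> ta irr L0 Lf; have [B [BB BL]] := orthonormal_basis L.
pose F i := sqnorm (a i) - sqnorm (a i *m B^T) -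
  (if a i \in orthc L then sqnorm (a i) else 0).
rewrite -subr_gt0; have -> : d%:R - (\dim L)%:R -
    \sum_(i | a i \in orthc L) sqnorm (a i) = \sum_i F i.
  rewrite [X in _ - X]big_mkcond /= -(tight_sum ta).
  by rewrite -(tight_orthonormal ta BB) -!sumrB.
have F0 i : true -> 0 <= F i.
  move=> _; rewrite /F; case: ifPn => [/orthcP h|_].
    suff -> : a i *m B^T = 0 by rewrite /sqnorm inner0l subr0 subrr.
    apply/rowP => r; rewrite mulmx_tr_inner mxE; apply: h; rewrite BL.
    by rewrite -row_mul BB row1 rowE.
  by rewrite subr0 subr_ge0 (sqnorm_orthonormal (a i) BB) lerDl sqnorm_ge0.
rewrite lt_def sumr_ge0 ?andbT//; apply/negP => /eqP/eqP.
rewrite psumr_eq0// => /allP h; apply: irr; exists L, (orthc L).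
split=> //; last 1 first.
- move=> i; have := h i; rewrite mem_index_enum => /(_ isT) /=; rewrite /F.
  case: ifPn => [_ _|_]; first by rewrite orbT.
  rewrite subr0 (sqnorm_orthonormal (a i) BB) addrC addKr sqnorm_eq0 subr_eq0.
  by rewrite BL => ->.
- by apply: contra Lf => /eqP L0'; rewrite -(add_orthc L) L0' addv0.
- exact: directv_orthc.
- exact: add_orthc.
Qed.

End TightFrames.

(** * The Hirzebruch form of a tight frame *)

Section HirzebruchForm.
Variables (R : realType) (d n : nat).
Implicit Types (a : 'I_n -> 'rV[R]_d) (H : 'I_n -> {vspace 'rV[R]_d}).
Implicit Types (S P : {vspace 'rV[R]_d}) (J K : {set 'I_n}).

Lemma mem_codim2 H S : S \in codim2 H <->
  (\dim S + 2)%N = d /\ exists2 J : {set 'I_n}, (3 <= #|J|)%N & S = inter_hyp H J.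
Proof.
rewrite /codim2 mem_undup mem_filter; split.
  case/andP => /eqP dS /mapP[J]; rewrite mem_enum inE => J3 SJ.
  by split=> //; exists J.
case=> -> [J J3 ->]; rewrite eqxx /=; apply/mapP; exists J => //.
by rewrite mem_enum inE.
Qed.

Lemma sub_inter_hyp a J S :
  (S <= inter_hyp (fun i => perp (a i)) J)%VS = (J \subset in_plane a (orthc S)).
Proof.
apply/subv_bigcapP/fintype.subsetP => h i iJ; have := h i iJ.
  by rewrite sub_perp inE.
by rewrite inE sub_perp.
Qed.

Lemma inter_hyp_perp a J :
  inter_hyp (fun i => perp (a i)) J = orthc (\sum_(i in J) <[a i]>)%VS.
Proof.
apply/vspaceP => x; rewrite -sub_perp memvE.
apply/subv_bigcapP/subv_sumP => h i iJ; have := h i iJ.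
  by rewrite -!memvE !mem_perp innerC.
by rewrite -!memvE !mem_perp innerC.
Qed.

Lemma dim_pair (x y : 'rV[R]_d) : x != 0 -> y \notin <[x]>%VS ->
  \dim (<[x]> + <[y]>) = 2%N.
Proof.
move=> x0 yx; have y0 : y != 0 by apply: contraNneq yx => ->; exact: mem0v.
rewrite dimv_disjoint_sum ?dim_vline ?x0 ?y0//.
apply/eqP; rewrite -subv0; apply/subvP => z; rewrite memv_cap => /andP[zx].
case/vlineP => k zky; rewrite memv0 zky scaler_eq0 (negbTE y0) orbF.
apply: contraNT yx => k0; rewrite -[y](scalerK k0) -zky.
by rewrite rpredZ.
Qed.

Lemma plane_pair (x y : 'rV[R]_d) P : x != 0 -> y \notin <[x]>%VS ->
  x \in P -> y \in P -> \dim P = 2%N -> P = (<[x]> + <[y]>)%VS.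
Proof.
move=> x0 yx xP yP dP; apply/esym/eqP.
by rewrite eqEdim dim_pair// dP andbT subv_add -!memvE xP yP.
Qed.

(** Orthogonal complement turns the codimension-2 flats counted by the
    Hirzebruch form into the planes of condition [vee_V2]. *)
Lemma codim2_plane a (ane : forall i, a i != 0)
    (anp : forall i j, i != j -> a i \notin <[a j]>%VS) S :
  S \in codim2 (fun i => perp (a i)) <->
  \dim (orthc S) = 2%N /\ (3 <= #|in_plane a (orthc S)|)%N.
Proof.
have dO := dim_orthc S; split=> [/mem_codim2[dS [J J3 SJ]]|[dS K3]].
  split; first lia.
  by apply: leq_trans J3 (subset_leq_card _); rewrite -sub_inter_hyp SJ subvv.
apply/mem_codim2; split; first lia.
exists (in_plane a (orthc S)) => //.
set S' := inter_hyp _ _; have SS' : (S <= S')%VS by rewrite sub_inter_hyp.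
have : in_plane a (orthc S) \subset in_plane a (orthc S').
  by rewrite -sub_inter_hyp subvv.
move/fintype.subsetP => KK.
have /card_gt1P[i [j [iK jK ij]]] : (1 < #|in_plane a (orthc S)|)%N by lia.
have := KK i iK; have := KK j jK; move: iK jK; rewrite !inE => iS jS jS' iS'.
apply/eqP; rewrite -[S]orthcK eq_sym -[S']orthcK.
suff -> : orthc S = orthc S' by [].
apply/eqP; rewrite eq_sym eqEdim orthcS// (plane_pair (ane j) (anp _ _ ij) jS iS dS).
by rewrite dimvS// subv_add -!memvE jS' iS'.
Qed.

(** In an orthonormal basis of the plane, A, B and D are the entries of the
    frame operator of the vectors indexed by K. *)
Lemma plane_coordinates a P K : \dim P = 2%N -> (forall i, i \in K -> a i \in P) ->
  exists A B D : R, [/\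
    \sum_(i in K) sqnorm (a i) = A + D,
    \sum_(i in K) \sum_(j in K) inner (a i) (a j) ^+ 2 =
      A ^+ 2 + 2 * B ^+ 2 + D ^+ 2,
    forall x, x \in P -> exists s t, sqnorm x = s ^+ 2 + t ^+ 2 /\
      \sum_(i in K) inner x (a i) ^+ 2 = s ^+ 2 * A + 2 * s * t * B + t ^+ 2 * D
  & forall s t, exists2 x, x \in P & sqnorm x = s ^+ 2 + t ^+ 2 /\
      \sum_(i in K) inner x (a i) ^+ 2 = s ^+ 2 * A + 2 * s * t * B + t ^+ 2 * D].
Proof.
move=> dP KP; have := orthonormal_basis P; rewrite dP => -[E [EE EP]].
pose p (x : 'rV[R]_d) := (x *m E^T) 0 0; pose q (x : 'rV[R]_d) := (x *m E^T) 0 1.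
have pq x y : x \in P -> inner x y = p x * p y + q x * q y.
  rewrite EP => /eqP xE; rewrite [in LHS]xE inner_mulmx innerE.
  by rewrite big_ord_recl big_ord1 (_ : lift _ _ = 1)//; apply: val_inj.
pose A := \sum_(i in K) p (a i) ^+ 2; pose B := \sum_(i in K) p (a i) * q (a i).
pose D := \sum_(i in K) q (a i) ^+ 2; exists A, B, D.
have sumx x : x \in P -> \sum_(i in K) inner x (a i) ^+ 2 =
    p x ^+ 2 * A + 2 * p x * q x * B + q x ^+ 2 * D.
  move=> xP; rewrite !mulr_sumr -!big_split /=; apply: eq_bigr => i _.
  by rewrite pq//; ring.
split.
- rewrite -big_split /=; apply: eq_bigr => i iK.
  by rewrite /sqnorm pq ?KP//; ring.
- under eq_bigr => i iK do rewrite sumx ?KP//.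
  rewrite !big_split /= -!mulr_suml -/A -/D.
  under [X in X * B]eq_bigr do rewrite -mulrA.
  by rewrite -mulr_sumr -/B; ring.
- move=> x xP; exists (p x), (q x); split; last exact: sumx.
  by rewrite /sqnorm pq//; ring.
move=> s t; pose u : 'rV[R]_2 := \row_i (if i == 0 then s else t).
have uE : u *m E *m E^T = u by rewrite -mulmxA EE mulmx1.
have uP : u *m E \in P by rewrite EP uE.
have ps : p (u *m E) = s by rewrite /p uE mxE.
have qt : q (u *m E) = t by rewrite /q uE mxE.
exists (u *m E) => //; split; last by rewrite sumx// ps qt.
by rewrite /sqnorm pq// ps qt; ring.
Qed.

(** With the entries of [plane_coordinates], the defect is
    (A - D)^2 / 2 + 2 B^2: it is nonnegative, and zero exactly when the frame
    operator of the plane is scalar. *)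
Lemma plane_defect a P K : \dim P = 2%N -> (forall i, i \in K -> a i \in P) ->
  let defect := \sum_(i in K) \sum_(j in K) inner (a i) (a j) ^+ 2
     - 2^-1 * (\sum_(i in K) sqnorm (a i)) ^+ 2 in
  0 <= defect /\
  (defect = 0 <-> exists nu : R, forall x, x \in P ->
     \sum_(i in K) inner x (a i) ^+ 2 = nu * sqnorm x).
Proof.
move=> dP KP /=; have [A [B [D [-> -> hP hst]]]] := plane_coordinates dP KP.
have -> : A ^+ 2 + 2 * B ^+ 2 + D ^+ 2 - 2^-1 * (A + D) ^+ 2 =
   2^-1 * (A - D) ^+ 2 + 2 * B ^+ 2 by field.
have := sqr_ge0 (A - D); have := sqr_ge0 B => B0 AD0.
split; first lra.
split=> [h|[nu h]].
  have B20 : B ^+ 2 = 0 by lra.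
  have AD20 : (A - D) ^+ 2 = 0 by lra.
  have DA : D = A by apply/esym/eqP; rewrite -subr_eq0 -sqrf_eq0 AD20.
  have BZ : B = 0 by apply/eqP; rewrite -sqrf_eq0 B20.
  by exists A => x /hP[s [t [-> ->]]]; rewrite DA BZ; ring.
(* Test vectors with coordinates (1, 0), (0, 1) and (1, 1). *)
have [x xP [x1 x2]] := hst 1 0; have := h x xP; rewrite x1 x2.
have [y yP [y1 y2]] := hst 0 1; have := h y yP; rewrite y1 y2.
have [z zP [z1 z2]] := hst 1 1; have := h z zP; rewrite z1 z2.
move=> e3 e2 e1; have -> : A = nu by lra.
have -> : D = nu by lra.
have -> : B = 0 by lra.
by ring.
Qed.

End HirzebruchForm.

Section HirzebruchVee.
Variables (R : realType) (d n : nat) (a : 'I_n -> 'rV[R]_d).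
Hypothesis d_gt0 : (0 < d)%N.
Hypothesis ta : tight a.
Hypothesis ane : forall i, a i != 0.
Hypothesis anp : forall i j, i != j -> a i \notin <[a j]>%VS.
Implicit Types (S P : {vspace 'rV[R]_d}).

Let H i := perp (a i).
Let I S := in_plane a (orthc S).
Let m i j := count (fun S => (i \in I S) && (j \in I S)) (codim2 H).

Definition plane_excess S : R :=
  \sum_(i in I S) \sum_(j in I S) inner (a i) (a j) ^+ 2
  - 2^-1 * (\sum_(i in I S) sqnorm (a i)) ^+ 2.

Lemma mem_codim2_perp S : S \in codim2 H <->
  \dim (orthc S) = 2%N /\ (3 <= #|I S|)%N.
Proof. exact: codim2_plane. Qed.

Lemma codim2_pair S S' i j : i != j -> S \in codim2 H -> S' \in codim2 H ->
  i \in I S -> j \in I S -> i \in I S' -> j \in I S' -> S = S'.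
Proof.
move=> ij /mem_codim2_perp[dS _] /mem_codim2_perp[dS' _]; rewrite !inE.
move=> iS jS iS' jS'; rewrite -[S]orthcK -[S']orthcK; congr orthc.
by rewrite (plane_pair (ane j) (anp ij) jS iS)// (plane_pair (ane j) (anp ij) jS' iS').
Qed.

(** Two distinct frame vectors span one plane, so that they lie together in at
    most one of the planes that are counted. *)
Lemma codim2_pair_count i j : i != j -> (m i j <= 1)%N.
Proof.
move=> ij; rewrite /m -size_filter leqNgt; apply/negP => /[dup] h1 /ltnW h0.
set s := seq.filter _ _ in h0 h1; have us : uniq s by rewrite filter_uniq// undup_uniq.
have e0 := mem_nth 0%VS h0; have e1 := mem_nth 0%VS h1.
have /eqP := nth_uniq 0%VS h0 h1 us; rewrite eq_sym => /eqP.
move: e0 e1; rewrite !mem_filter => /andP[/andP[i0 j0] G0] /andP[/andP[i1 j1] G1].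
by rewrite (codim2_pair ij G0 G1 i0 j0 i1 j1) eqxx.
Qed.

(** The double sum of (a_i, a_j)^2 over all pairs is d.  Each pair i <> j is
    counted [m i j] times, that is at most once, in the planes of [codim2 H],
    and the pair (i, i) is counted in as many planes as sigma_i says. *)
Lemma hirzebruch_formE :
  - 2 * hirzebruch_form H (fun i => sqnorm (a i)) =
  \sum_(S <- codim2 H) plane_excess S +
  \sum_i \sum_(j | j != i) (1 - (m i j)%:R) * inner (a i) (a j) ^+ 2.
Proof.
have IE S i : (S <= H i)%VS = (i \in I S) by rewrite sub_perp inE.
have sigE i : count (fun S => (S <= H i)%VS) (codim2 H) = m i i.
  by apply: eq_count => S; rewrite IE andbb.
pose g i j := inner (a i) (a j) ^+ 2.
have sum_g : \sum_i \sum_j g i j = d%:R.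
  by rewrite -(tight_sum ta); apply: eq_bigr => i _; rewrite /g ta.
have sum_m : \sum_(S <- codim2 H) \sum_(i in I S) \sum_(j in I S) g i j =
    \sum_i \sum_j (m i j)%:R * g i j.
  under eq_bigr do rewrite big_mkcond.
  rewrite exchange_big /=; apply: eq_bigr => i _.
  transitivity (\sum_(S <- codim2 H) \sum_j
     ((i \in I S) && (j \in I S))%:R * g i j).
    apply: eq_bigr => S _; case: (i \in I S); last first.
      by rewrite big1// => j _; rewrite mul0r.
    rewrite big_mkcond; apply: eq_bigr => j _ /=.
    by case: (j \in I S); rewrite ?mul1r ?mul0r.
  rewrite exchange_big /=; apply: eq_bigr => j _; rewrite -mulr_suml.
  congr (_ * _); rewrite /m -sum1_count natr_sum [RHS]big_mkcond /=.
  by apply: eq_bigr => S _; case: (_ && _).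
have diag (F : 'I_n -> 'I_n -> R) :
    \sum_i \sum_j F i j = \sum_i F i i + \sum_i \sum_(j | j != i) F i j.
  by rewrite -big_split; apply: eq_bigr => i _; rewrite (bigD1 i).
rewrite /hirzebruch_form (tight_sum ta) /plane_excess sumrB sum_m diag.
move: sum_g; rewrite diag.
have -> : \sum_(S <- codim2 H) (2^-1 * (\sum_(i | (S <= H i)%VS) sqnorm (a i))) ^+ 2
  = 2^-1 * \sum_(S <- codim2 H) 2^-1 * (\sum_(i in I S) sqnorm (a i)) ^+ 2.
  rewrite mulr_sumr; apply: eq_bigr => S _.
  rewrite (eq_bigl (mem (I S))) ?exprMn; first by rewrite expr2; ring.
  by move=> i; rewrite IE.
have -> : \sum_i ((count (fun S => (S <= H i)%VS) (codim2 H))%:R - 1) *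
    sqnorm (a i) ^+ 2 = \sum_i (m i i)%:R * g i i - \sum_i g i i.
  by rewrite -sumrB; apply: eq_bigr => i _; rewrite sigE mulrBl mul1r.
have -> : \sum_i \sum_(j | j != i) (1 - (m i j)%:R) * inner (a i) (a j) ^+ 2 =
    \sum_i \sum_(j | j != i) g i j - \sum_i \sum_(j | j != i) (m i j)%:R * g i j.
  rewrite -sumrB; apply: eq_bigr => i _; rewrite -sumrB.
  by apply: eq_bigr => j _; rewrite mulrBl mul1r.
have -> : (2 * d%:R)^-1 * d%:R ^+ 2 = 2^-1 * d%:R :> R.
  by field; rewrite pnatr_eq0 -lt0n.
by move=> <-; field.
Qed.

(** All terms of [hirzebruch_formE] are nonnegative, so that Q vanishes exactly
    when each of them does: by [plane_defect] the first sum expresses [vee_V2],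
    and the second one expresses [vee_V3] because [m i j] = 0 when the plane of
    i and j contains no third vector. *)
Lemma hirzebruch_vee :
  hirzebruch_form H (fun i => sqnorm (a i)) = 0 <-> vee_system a.
Proof.
have ex0 S : S \in codim2 H -> 0 <= plane_excess S /\
    (plane_excess S = 0 <-> exists nu : R, forall x, x \in orthc S ->
     \sum_(i in I S) inner x (a i) ^+ 2 = nu * sqnorm x).
  move=> /mem_codim2_perp[dS _]; apply: plane_defect => // i.
  by rewrite inE.
have t0 i j : j != i -> 0 <= (1 - (m i j)%:R) * inner (a i) (a j) ^+ 2.
  move=> ji; rewrite mulr_ge0 ?sqr_ge0// subr_ge0 lern1 codim2_pair_count//.
  by rewrite eq_sym.
have sum_eq0 : hirzebruch_form H (fun i => sqnorm (a i)) = 0 <->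
   (forall S, S \in codim2 H -> plane_excess S = 0) /\
   (forall i j, j != i -> (1 - (m i j)%:R) * inner (a i) (a j) ^+ 2 = 0).
  have e0 : 0 <= \sum_(S <- codim2 H) plane_excess S.
    by rewrite big_seq sumr_ge0// => S /ex0[].
  have e1 : 0 <= \sum_i \sum_(j | j != i) (1 - (m i j)%:R) * inner (a i) (a j) ^+ 2.
    by rewrite sumr_ge0// => i _; rewrite sumr_ge0// => j; apply: t0.
  have := hirzebruch_formE; set Q := hirzebruch_form _ _ => QE; split.
    move=> Q0; rewrite Q0 mulr0 in QE.
    move/esym/eqP: QE; rewrite paddr_eq0// => /andP[].
    rewrite big_seq psumr_eq0 => [/allP h /eqP k|S /ex0[]//]; split.
      by move=> S SG; apply/eqP; have := h S SG; rewrite SG.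
    move=> i j ji.
    move/eqP: k; rewrite psumr_eq0 => [|i' _]; last first.
      by rewrite sumr_ge0// => j'; apply: t0.
    move=> /allP/(_ i); rewrite mem_index_enum => /(_ isT) /=.
    rewrite psumr_eq0 => [|j']; last exact: t0.
    by move=> /allP/(_ j); rewrite mem_index_enum ji => /(_ isT) /= /eqP.
  case=> h k; move: QE; rewrite big_seq big1 ?add0r => [|S /h//].
  rewrite big1 => [|i _]; last by rewrite big1// => j /k.
  by lra.
rewrite sum_eq0; split=> [[hG hpair]|[_ _ _ V2 V3]].
- split=> //.
  + move=> P dP P3; have PG : orthc P \in codim2 H.
      by apply/mem_codim2_perp; rewrite /I orthcK.
    by have [_ [/(_ (hG _ PG))]] := ex0 _ PG; rewrite /I orthcK.
  + move=> P dP i j ij Pij.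
    have iP : a i \in P by have := set21 i j; rewrite -Pij inE.
    have jP : a j \in P by have := set22 i j; rewrite -Pij inE.
    have ji : j != i by rewrite eq_sym.
    have := hpair _ _ ji; suff -> : m i j = 0%N.
      by rewrite subr0 mul1r => /eqP; rewrite sqrf_eq0 => /eqP.
    apply/eqP; rewrite -leqn0 leqNgt -has_count; apply/hasP => -[S SG].
    have /mem_codim2_perp[dS S3] := SG; rewrite !inE => /andP[iS jS].
    have SP : orthc S = P.
      by rewrite (plane_pair (ane j) (anp ij) jS iS)//
        (plane_pair (ane j) (anp ij) jP iP).
    by move: S3; rewrite /I SP Pij cards2 ij.
- split=> [S SG|i j ji].
    by apply/(ex0 _ SG).2; have /mem_codim2_perp[dS S3] := SG; apply: V2.
  have [m0|m0] := posnP (m i j); last first.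
    suff -> : m i j = 1%N by rewrite subrr mul0r.
    by apply/eqP; rewrite eqn_leq m0 codim2_pair_count// eq_sym.
  have ij : i != j by rewrite eq_sym.
  pose P := (<[a j]> + <[a i]>)%VS.
  have dP : \dim P = 2%N by rewrite dim_pair// anp.
  have iP : a i \in P by rewrite memvE addvSr.
  have jP : a j \in P by rewrite memvE addvSl.
  have sP : [set i; j] \subset in_plane a P.
    by apply/fintype.subsetP => k; rewrite !inE => /orP[]/eqP ->.
  suff PE : in_plane a P = [set i; j].
    by rewrite (V3 P dP i j ij PE) expr0n mulr0.
  apply/esym/eqP; rewrite eqEcard sP cards2 ij leqNgt; apply/negP => P3.
  have PG : orthc P \in codim2 H by apply/mem_codim2_perp; rewrite /I orthcK.
  have : (0 < m i j)%N.
    by rewrite /m -has_count; apply/hasP; exists (orthc P);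
      rewrite // /I orthcK !inE iP jP.
  by rewrite m0.
Qed.

End HirzebruchVee.

(** * The two equivalence relations *)

Section Equivalences.
Variables (R : realType) (d n : nat).
Implicit Types (a b : 'I_n -> 'rV[R]_d) (X Y Z : warrangement R d n).

Lemma lker0_id : lker (\1%VF : 'End('rV[R]_d)) == 0%VS.
Proof. by apply/lker0P => x y; rewrite !lfunE. Qed.

Lemma lker0_comp (F G : 'End('rV[R]_d)) :
  lker F == 0%VS -> lker G == 0%VS -> lker (G \o F)%VF == 0%VS.
Proof.
move=> /lker0P Fi /lker0P Gi; apply/lker0P => x y.
by rewrite !comp_lfunE => /Gi /Fi.
Qed.

Lemma lker0_inv (F : 'End('rV[R]_d)) : lker F == 0%VS -> lker F^-1%VF == 0%VS.
Proof. by move=> kF; apply/lker0P; apply: can_inj (lker0_lfunVK kF). Qed.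

Lemma lin_equiv_refl X : lin_equiv X X.
Proof.
split=> //; exists \1%VF; first exact: lker0_id.
by move=> i; rewrite lim1g.
Qed.

Lemma lin_equiv_sym X Y : lin_equiv X Y -> lin_equiv Y X.
Proof.
case=> -[F kF hF] wF; split=> //; exists F^-1%VF; first exact: lker0_inv.
by move=> i; rewrite hF -limg_comp lker0_compVf// lim1g.
Qed.

Lemma lin_equiv_trans X Y Z : lin_equiv X Y -> lin_equiv Y Z -> lin_equiv X Z.
Proof.
case=> -[F kF hF] wF -[[G kG hG] wG]; split=> [|i]; last by rewrite wG.
exists (G \o F)%VF; first exact: lker0_comp.
by move=> i; rewrite hG hF limg_comp.
Qed.

Lemma isometry_lker0 (G : 'End('rV[R]_d)) :
  (forall x, sqnorm (G x) = sqnorm x) -> lker G == 0%VS.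
Proof.
move=> iG; rewrite -subv0; apply/subvP => x; rewrite memv_ker memv0 => /eqP Gx.
by rewrite -sqnorm_eq0 -iG Gx sqnorm_eq0.
Qed.

Lemma isometry_inner (G : 'End('rV[R]_d)) :
  (forall x, sqnorm (G x) = sqnorm x) -> forall x y, inner (G x) (G y) = inner x y.
Proof.
move=> iG x y; have := iG (x + y); rewrite linearD !sqnormD !iG; lra.
Qed.

Lemma orth_proj_equiv_refl a : orth_proj_equiv a a.
Proof. by exists \1%VF => [x|i]; [|left]; rewrite lfunE. Qed.

Lemma orth_proj_equiv_sym a b : orth_proj_equiv a b -> orth_proj_equiv b a.
Proof.
case=> G iG hG; have kG := isometry_lker0 iG; exists G^-1%VF.
  by move=> x; rewrite -iG lker0_lfunVK.
move=> i; case: (hG i) => ->; [left|right]; rewrite ?linearN /=.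
  by rewrite lker0_lfunK.
by rewrite opprK lker0_lfunK.
Qed.

Lemma orth_proj_equiv_trans a b c :
  orth_proj_equiv a b -> orth_proj_equiv b c -> orth_proj_equiv a c.
Proof.
case=> F iF hF [G iG hG]; exists (G \o F)%VF => [x|i].
  by rewrite comp_lfunE iG iF.
rewrite comp_lfunE; case: (hG i) => ->; case: (hF i) => ->.
- by left.
- by right; rewrite linearN.
- by right.
- by left; rewrite linearN opprK.
Qed.

Lemma orth_proj_lin_equiv a b :
  orth_proj_equiv a b -> lin_equiv (arrangement_of a) (arrangement_of b).
Proof.
case=> G iG hG; have kG := isometry_lker0 iG; split=> /= [|i]; last first.
  by case: (hG i) => ->; rewrite ?sqnormN iG.
exists G => // i.
have -> : perp (b i) = perp (G (a i)).
  apply/vspaceP => x; rewrite !mem_perp; case: (hG i) => -> //.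
  by rewrite innerNr oppr_eq0.
apply/vspaceP => x; rewrite mem_perp -[x](lker0_lfunVK kG).
rewrite isometry_inner// -mem_perp.
apply/idP/idP => [h|/memv_imgP[y yP /(lker0P kG) ->]//].
exact: memv_img.
Qed.

End Equivalences.

(** The map on classes is the saturation of the image under [f], which makes it
    independent of representatives without any choice. *)
Lemma eq_classes_bij (T U : Type) (D : set T) (E : set U) (eT : T -> T -> Prop)
    (eU : U -> U -> Prop) (f : T -> U) :
  (forall x, eT x x) -> (forall x y, eT x y -> eT y x) ->
  (forall x y z, eT x y -> eT y z -> eT x z) ->
  (forall x, eU x x) -> (forall x y, eU x y -> eU y x) ->
  (forall x y z, eU x y -> eU y z -> eU x z) ->
  (forall x, D x -> E (f x)) ->
  (forall x y, D x -> D y -> eT x y <-> eU (f x) (f y)) ->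
  (forall u, E u -> exists2 x, D x & eU (f x) u) ->
  exists2 Phi : set T -> set U,
    set_bij (eq_classes D eT) (eq_classes E eU) Phi
    & forall x, D x -> Phi (eq_class D eT x) = eq_class E eU (f x).
Proof.
move=> rT sT tT rU sU tU fDE ef fsurj.
pose Phi (C : set T) : set U := [set u | E u /\ exists2 x, C x & eU (f x) u]%classic.
have PhiE x : D x -> Phi (eq_class D eT x) = eq_class E eU (f x).
  move=> Dx; apply/seteqP; split=> u [Eu] /=.
    by case=> y [Dy xy] yu; split=> //; apply: tU yu; apply/ef.
  by move=> xu; split=> //; exists x.
exists Phi => //; split.
- by move=> _ [x Dx <-]; exists (f x); [exact: fDE|rewrite PhiE].
- move=> C C' /set_mem[x Dx <-] /set_mem[y Dy <-]; rewrite !PhiE// => exy.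
  have xy : eT x y.
    apply/ef => //; have : eq_class E eU (f y) (f y) by split; [exact: fDE|].
    by rewrite -exy => -[].
  apply/seteqP; split=> z [Dz xz]; split=> //.
    by apply: tT xz; apply: sT.
  exact: tT xz.
- move=> _ [u Eu <-]; have [x Dx xu] := fsurj u Eu.
  exists (eq_class D eT x); first by exists x.
  rewrite PhiE//; apply/seteqP; split=> v [Ev h]; split=> //.
    by apply: tU h; apply: sU.
  exact: tU h.
Qed.

(** * Linear invariance of PK arrangements *)

Section Invariance.
Variables (R : realType) (d n : nat).
Implicit Types (X Y : warrangement R d n) (H : 'I_n -> {vspace 'rV[R]_d}).

Section Image.
Variable F : 'End('rV[R]_d).
Hypothesis kF : lker F == 0%VS.

Lemma limg_inj : injective (fun W : {vspace 'rV[R]_d} => (F @: W)%VS).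
Proof. by move=> V W /eqP; rewrite eq_limg_ker0// => /eqP. Qed.

Lemma dim_limg (W : {vspace 'rV[R]_d}) : \dim (F @: W) = \dim W.
Proof. by rewrite limg_dim_eq// (eqP kF) capv0. Qed.

Lemma inter_hyp_limg H J :
  inter_hyp (fun i => (F @: H i)%VS) J = (F @: inter_hyp H J)%VS.
Proof.
by rewrite /inter_hyp (big_morph _ (fun V W => lker0_img_cap V W kF) (lker0_limgf kF)).
Qed.

Lemma codim2_limg H : codim2 (fun i => (F @: H i)%VS) =
  [seq (F @: W)%VS | W <- codim2 H].
Proof.
rewrite /codim2 -(undup_map_inj limg_inj); congr undup.
rewrite (eq_map (inter_hyp_limg H)) (map_comp (fun S => (F @: S)%VS)) [LHS]filter_map.
by congr map; apply: eq_filter => S /=; rewrite dim_limg.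
Qed.

Lemma hirzebruch_form_limg H w :
  hirzebruch_form (fun i => (F @: H i)%VS) w = hirzebruch_form H w.
Proof.
rewrite /hirzebruch_form codim2_limg big_map; congr (_ - _ * _ - _).
  apply: eq_bigr => S _; congr ((_ * _) ^+ _).
  by apply: eq_bigl => i; rewrite limg_ker0.
apply: eq_bigr => i _; rewrite count_map; congr ((_%:R - _) * _).
by apply: eq_count => S /=; rewrite limg_ker0.
Qed.

End Image.

Lemma PK_lin_equiv X Y : PK_arrangement X -> lin_equiv X Y -> PK_arrangement Y.
Proof.
case: X Y => H w [H' w'] [/= hdim hinj hw h1 h2 h3] [[F kF /= hF] /= wE].
have {}hF : H' = fun i => (F @: H i)%VS by apply/funext.
have {}wE : w' = w by apply/funext.
subst H' w'; split=> //=.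
- by move=> i; rewrite dim_limg.
- by move=> i j /(limg_inj kF) /hinj.
- move=> J; rewrite inter_hyp_limg// => L0 Lf; rewrite dim_limg//.
  under eq_bigl do rewrite limg_ker0//.
  apply: h2; first by apply: contra_neq L0 => ->; rewrite limg0.
  by apply: contra_neq Lf => ->; apply: lker0_limgf.
- by rewrite hirzebruch_form_limg.
Qed.

End Invariance.

(** * Irreducible vee-systems and PK arrangements *)

Section VeeArrangement.
Variables (R : realType) (d n : nat).
Implicit Types (a : 'I_n -> 'rV[R]_d).
Hypothesis hd : (2 <= d)%N.

(** The bound |a_i|^2 < 1 is the stability inequality for the hyperplane
    orthogonal to a_i. *)
Lemma vee_PK a : irreducible_vee_system a -> PK_arrangement (arrangement_of a).
Proof.
case=> va irr; have [ane anp ta _ _] := va; split=> /=.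
- by move=> i; apply: dim_perp.
- move=> i j ij; apply/eqP; apply/negPn/negP => /anp/negP; apply.
  by rewrite -orthc_perp -ij orthc_perp memv_line.
- move=> i; rewrite sqnorm_gt0 ane /=; have dp := dim_perp (ane i).
  have p0 : perp (a i) != 0%VS by rewrite -dimv_eq0; lia.
  have pf : perp (a i) != fullv.
    by apply/eqP => pf; move: dp; rewrite pf dimvf /dim /= mul1n; lia.
  have lt1 := tight_stable ta irr p0 pf.
  have -> : 1 = d%:R - (\dim (perp (a i)))%:R :> R by rewrite -[X in X%:R - _]dp
    natrD addrC addKr.
  apply: le_lt_trans lt1; rewrite (bigD1 i) /=; last by rewrite orthc_perp memv_line.
  by rewrite lerDl sumr_ge0// => j _; apply: sqnorm_ge0.
- exact: tight_sum.
- move=> J L0 Lf; under eq_bigl do rewrite sub_perp.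
  exact: tight_stable.
- by apply/hirzebruch_vee => //; lia.
Qed.

(** If the frame split along P and P', then [PK_PK2] at the flats orthogonal to the
    vectors in P and to those in P' would bound the two partial sums of weights
    strictly by dim P and dim P', whereas all weights add up to
    d = dim P + dim P'. *)
Lemma PK_vee a : tight a -> PK_arrangement (arrangement_of a) ->
  irreducible_vee_system a.
Proof.
move=> ta [/= _ hinj hw h1 h2 h3].
have ane i : a i != 0 by rewrite -sqnorm_gt0; case/andP: (hw i).
have anp i j : i != j -> a i \notin <[a j]>%VS.
  apply: contra_neqN => /vlineP[k ak]; apply: hinj.
  rewrite !perpE; congr orthc; apply/eqP.
  by rewrite eqEdim !dim_vline !ane -memvE ak rpredZ ?memv_line.
split; first by apply/hirzebruch_vee => //; lia.
case=> P [P' [P0 P'0 /directv_addP dPP sPP aPP]].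
pose U (Q : {vspace 'rV[R]_d}) := (\sum_(i in in_plane a Q) <[a i]>)%VS.
have aU (Q : {vspace 'rV[R]_d}) i : a i \in Q -> a i \in U Q.
  by move=> aQ; rewrite memvE (sumv_sup i) ?inE.
have UQ (Q : {vspace 'rV[R]_d}) : (U Q <= Q)%VS.
  by apply/subv_sumP => i; rewrite inE -memvE.
have ltU (Q : {vspace 'rV[R]_d}) : Q != 0%VS -> Q != fullv ->
  \sum_(i | a i \in Q) sqnorm (a i) < (\dim Q)%:R.
  move=> Q0 Qf; have dU := dim_orthc (U Q).
  have [U0|U0] := eqVneq (U Q) 0%VS.
    rewrite big1 ?ltr0n ?lt0n ?dimv_eq0// => i /aU.
    by rewrite U0 memv0 (negbTE (ane i)).
  have orthE := inter_hyp_perp a (in_plane a Q).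
  have dimf : \dim (fullv : {vspace 'rV[R]_d}) = d by rewrite dimvf /dim /= mul1n.
  have oU0 : orthc (U Q) != 0%VS.
    move: Qf; rewrite eqEdim subvf dimf -ltnNge => dQ.
    rewrite -dimv_eq0 -lt0n -(ltn_add2l (\dim (U Q))) addn0 dU.
    exact: leq_ltn_trans (dimvS (UQ Q)) dQ.
  have oUf : orthc (U Q) != fullv.
    by apply: contra_neq U0 => oU; apply/eqP;
      rewrite -dimv_eq0 -(eqn_add2r d) -[X in (_ + X)%N]dimf -oU dU.
  have := h2 (in_plane a Q); rewrite orthE -/(U Q) => /(_ oU0 oUf) lt.
  have leU : \sum_(i | a i \in Q) sqnorm (a i) <=
      \sum_(i | a i \in U Q) sqnorm (a i).
    rewrite [leLHS]big_mkcond [leRHS]big_mkcond; apply: ler_sum => i _.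
    by case: ifPn => [/aU ->//|_]; case: ifP => // _; apply: sqnorm_ge0.
  apply: le_lt_trans leU _.
  have -> : \sum_(i | a i \in U Q) sqnorm (a i) =
     \sum_(i | (orthc (U Q) <= perp (a i))%VS) sqnorm (a i).
    by apply: eq_bigl => i; rewrite sub_perp orthcK.
  apply: lt_le_trans lt _.
  rewrite lerBlDr -natrD ler_nat -[leqLHS]dU leq_add2r.
  exact: dimvS.
have P'f : P' != fullv.
  by apply: contraNneq P0 => P'f; rewrite -dPP P'f capvf.
have Pf : P != fullv.
  by apply: contraNneq P'0 => Pf; rewrite -dPP Pf capfv.
have dd : (\dim P + \dim P')%N = d.
  by rewrite -dimv_disjoint_sum// sPP dimvf /dim /= mul1n.
have := ltrD (ltU P P0 Pf) (ltU P' P'0 P'f); rewrite -natrD dd -h1.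
apply/negP; rewrite -leNgt [X in _ <= X + _]big_mkcond [X in _ <= _ + X]big_mkcond.
rewrite -big_split /=.
apply: ler_sum => i _; have := sqnorm_ge0 (a i).
by have /orP[->|->] := aPP i; case: ifP => _; rewrite ?addr0 ?add0r ?lerDl ?lerDr.
Qed.

End VeeArrangement.

(** * Uniqueness of the tight frame *)

Section Continuity.
Variables (R : realType) (k : nat).
Implicit Types f g : 'rV[R]_k -> R.

Lemma continuous_mul f g :
  continuous f -> continuous g -> continuous (fun x => f x * g x).
Proof. by move=> cf cg x; apply: continuousM; [apply: cf|apply: cg]. Qed.

Lemma continuous_bigsum (I : Type) (r : seq I) (F : I -> 'rV[R]_k -> R) :
  (forall i, continuous (F i)) -> continuous (fun x => \sum_(i <- r) F i x).
Proof.
move=> cF; elim: r => [|i r IH].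
  by under eq_fun do rewrite big_nil; apply: cst_continuous.
under eq_fun do rewrite big_cons.
by move=> x; apply: continuousD; [apply: cF|apply: IH].
Qed.

Lemma continuous_bigprod (I : Type) (r : seq I) (F : I -> 'rV[R]_k -> R) :
  (forall i, continuous (F i)) -> continuous (fun x => \prod_(i <- r) F i x).
Proof.
move=> cF; elim: r => [|i r IH].
  by under eq_fun do rewrite big_nil; apply: cst_continuous.
under eq_fun do rewrite big_cons.
exact: continuous_mul.
Qed.

Lemma continuous_sqnorm_mulmx d (A : 'M[R]_(k, d)) :
  continuous (fun x : 'rV[R]_k => sqnorm (x *m A)).
Proof.
have cA r : continuous (fun x : 'rV[R]_k => (x *m A) 0 r).
  under eq_fun do rewrite mxE.
  apply: continuous_bigsum => j; apply: continuous_mul; last exact: cst_continuous.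
  exact: coord_continuous.
under eq_fun do rewrite sqnormE.
apply: continuous_bigsum => r; under eq_fun do rewrite expr2.
exact: continuous_mul.
Qed.

Lemma compact_box (m M : R) :
  compact [set x : 'rV[R]_k | forall i, m <= x 0 i <= M]%classic.
Proof.
have := @rV_compact R k (fun=> `[m, M]%classic) (fun=> @segment_compact R m M).
by congr compact; apply/seteqP; split=> x /= h i; have := h i; rewrite in_itv.
Qed.

End Continuity.

Section Uniqueness.
Variables (R : realType) (d n : nat).

Lemma rayleigh_max (A : 'M[R]_d) : (0 < d)%N ->
  exists l, (exists2 z : 'rV[R]_d, z != 0 & sqnorm (z *m A) = l * sqnorm z) /\
    forall x : 'rV[R]_d, sqnorm (x *m A) <= l * sqnorm x.
Proof.
move=> d0.
pose sphere := [set x : 'rV[R]_d | sqnorm x = 1]%classic.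
have coord_le (x : 'rV[R]_d) i : sqnorm x = 1 -> -1 <= x 0 i <= 1.
  rewrite sqnormE (bigD1 i)//= => x1.
  have : 0 <= \sum_(j | j != i) x 0 j ^+ 2 by apply: sumr_ge0 => j _; apply: sqr_ge0.
  move=> s0; have : x 0 i ^+ 2 <= 1 by lra.
  by move=> h; apply/andP; split; nra.
have sphere_compact : compact sphere.
  have sphereI : sphere = ([set x : 'rV[R]_d | forall i, (-1 : R) <= x 0 i
    <= 1] `&` sphere)%classic.
    by apply/seteqP; split=> x => [x1|[]//]; split=> // i; apply: coord_le.
  rewrite sphereI; apply: compact_closedI; first exact: compact_box.
  have := @continuous_sqnorm_mulmx R d d 1%:M.
  move=> /continuous_closedP/(_ _ (@closed_eq R 1)).
  by congr closed; apply/seteqP; split=> x; rewrite /= mulmx1.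
have sphere0 : (sphere !=set0)%classic.
  exists (delta_mx 0 (Ordinal d0)).
  by rewrite /sphere /= /sqnorm inner_delta mxE !eqxx.
have [z zS zmax] := EVT_max_rV sphere0 sphere_compact
  (continuous_subspaceT (@continuous_sqnorm_mulmx R d d A)).
move/set_mem: zS => z1; exists (sqnorm (z *m A)); split.
  exists z; last by rewrite z1 mulr1.
  by rewrite -sqnorm_gt0 z1.
move=> x; have [->|x0] := eqVneq x 0.
  by rewrite mul0mx /sqnorm !inner0l mulr0.
have nx0 : 0 < sqnorm x by rewrite sqnorm_gt0.
have nxS : (Num.sqrt (sqnorm x))^-1 *: x \in sphere.
  apply/mem_set; rewrite /sphere /= sqnormZ exprVn sqr_sqrtr ?sqnorm_ge0//.
  by rewrite mulVf// gt_eqF.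
have := zmax _ nxS; rewrite -scalemxAl sqnormZ exprVn sqr_sqrtr ?sqnorm_ge0//.
by rewrite mulrC ler_pdivrMr.
Qed.

(** The form q(y) = l |y|^2 - |y A|^2 is nonnegative and vanishes at x, so that
    its first variation at x vanishes in every direction; the residual
    y = l x - x A A^T is used as direction. *)
Lemma rayleigh_eigen (A : 'M[R]_d) l (x : 'rV[R]_d) :
  (forall y : 'rV[R]_d, sqnorm (y *m A) <= l * sqnorm y) ->
  sqnorm (x *m A) = l * sqnorm x -> x *m A *m A^T = l *: x.
Proof.
move=> lmax xl; pose y := l *: x - x *m A *m A^T.
suff y0 : y = 0 by apply/eqP; rewrite eq_sym -subr_eq0 -/y y0.
apply/eqP; apply/negPn/negP; rewrite -sqnorm_gt0 => p0.
pose c := l * sqnorm y - sqnorm (y *m A).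
have c0 : 0 <= c by rewrite subr_ge0.
(* A step this short makes the linear term of q(x + t y) dominate. *)
pose t := - (sqnorm y / (c + 1)).
have xy : l * inner x y - inner (x *m A) (y *m A) = sqnorm y.
  rewrite [in RHS]/sqnorm {2}/y innerDl innerZl innerNl; congr (_ - _).
  by rewrite [RHS]inner_mulmx trmxK.
have := lmax (x + t *: y); rewrite mulmxDl -scalemxAl !sqnormD !sqnormZ !innerZr xl.
rewrite -subr_ge0.
have -> : l * (sqnorm x + 2 * (t * inner x y) + t ^+ 2 * sqnorm y) -
  (l * sqnorm x + 2 * (t * inner (x *m A) (y *m A)) + t ^+ 2 * sqnorm (y *m A)) =
  2 * t * (l * inner x y - inner (x *m A) (y *m A)) + t ^+ 2 * c by rewrite /c; ring.
rewrite xy; apply/negP; rewrite -ltNge.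
have -> : 2 * t * sqnorm y + t ^+ 2 * c = - ((sqnorm y / (c + 1)) ^+ 2 * (c + 2)).
  by rewrite /t; field; rewrite gt_eqF//; lra.
by rewrite oppr_lt0 mulr_gt0 ?exprn_gt0 ?divr_gt0//; lra.
Qed.

(** Let l be the largest value of |x A|^2 / |x|^2 and E its eigenspace.
    Equality of norms gives k_i^2 |a_i A|^2 = |a_i|^2, hence k_i^2 >= 1 / l.
    Tightness of both frames, evaluated at x in E, says that
    sum_i (k_i^2 - 1 / l) (x, a_i)^2 = 0.  So a vector a_i that is not
    orthogonal to E has k_i^2 = 1 / l, which means |a_i A|^2 = l |a_i|^2, and
    lies in E. *)
Lemma tight_rigid (a b : 'I_n -> 'rV[R]_d) : (0 < d)%N ->
  (forall i, a i != 0) -> tight a -> ~ reducible a -> tight b ->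
  lin_equiv (arrangement_of a) (arrangement_of b) -> orth_proj_equiv a b.
Proof.
move=> d0 ane ta irr tb [[F kF /= hF] wab].
pose M := lin1_mx F; pose N := lin1_mx F^-1%VF; pose A := N^T.
have MN (x : 'rV[R]_d) : x *m M *m N = x by rewrite !mul_rV_lin1 /= lker0_lfunK.
have NM (x : 'rV[R]_d) : x *m N *m M = x by rewrite !mul_rV_lin1 /= lker0_lfunVK.
have /choice[k bE] i : exists k, b i = k *: (a i *m A).
  apply/vlineP; rewrite -(orthc_perp (a i *m A)) -[_ \in _]sub_perp hF.
  apply/subvP => x; rewrite mem_perp => x0.
  rewrite -[x](lker0_lfunVK kF) memv_img// mem_perp.
  by rewrite -[F^-1%VF x]mul_rV_lin1 inner_mulmx.
have kw i : k i ^+ 2 * sqnorm (a i *m A) = sqnorm (a i).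
  by rewrite -sqnormZ -bE; apply: wab.
have kM (x : 'rV[R]_d) : \sum_i k i ^+ 2 * inner x (a i) ^+ 2 = sqnorm (x *m M).
  rewrite -tb; apply: eq_bigr => i _.
  by rewrite bE innerZr [inner (x *m M) _]innerC inner_mulmx trmxK MN innerC exprMn.
have [l [[z z0 zl] lmax]] := rayleigh_max A d0.
have AN_eq0 (x : 'rV[R]_d) : x *m A = 0 -> x = 0.
  move=> xA0; apply/eqP; rewrite -sqnorm_eq0 /sqnorm -{2}(MN x).
  by rewrite innerC inner_mulmx -/A xA0 inner0r.
have l0 : 0 < l.
  have : 0 < l * sqnorm z.
    by rewrite -zl sqnorm_gt0; apply: contra_neq z0; apply: AN_eq0.
  by rewrite pmulr_lgt0// sqnorm_gt0.
pose E := lker (linfun (mulmxr (A *m A^T - l%:M) : 'rV[R]_d -> 'rV[R]_d)).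
have EP x : (x \in E) = (x *m A *m A^T == l *: x).
  by rewrite memv_ker lfunE /= mulmxBr mul_mx_scalar mulmxA subr_eq0.
have El x : x \in E -> sqnorm (x *m A) = l * sqnorm x.
  by rewrite EP => /eqP xE; rewrite {1}/sqnorm inner_mulmx xE innerZr.
have lE x : sqnorm (x *m A) = l * sqnorm x -> x \in E.
  by move=> xl; rewrite EP; apply/eqP/rayleigh_eigen.
have EM x : x \in E -> sqnorm (x *m M) = l^-1 * sqnorm x.
  move=> xE; have := El x xE; move: xE; rewrite EP trmxK => /eqP xE.
  have -> : x *m A = l *: (x *m M) by rewrite scalemxAl -xE NM.
  rewrite sqnormZ expr2 -mulrA => /(mulfI (lt0r_neq0 l0)) <-.
  by rewrite mulKf// lt0r_neq0.
have kl i : l^-1 <= k i ^+ 2.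
  rewrite -(ler_pM2r (x := sqnorm (a i))) ?sqnorm_gt0// -{1}kw mulrCA.
  by rewrite ler_wpM2l ?sqr_ge0// mulrC ler_pdivrMr// mulrC lmax.
have kE i x : x \in E -> inner x (a i) != 0 -> k i ^+ 2 = l^-1.
  move=> xE xa; have := EM x xE; rewrite -kM -ta mulr_sumr => /eqP.
  rewrite -subr_eq0 -sumrB psumr_eq0 => [/allP/(_ i)|j _]; last first.
    by rewrite -mulrBl mulr_ge0 ?sqr_ge0// subr_ge0.
  rewrite mem_index_enum => /(_ isT) /=.
  by rewrite -mulrBl mulf_eq0 sqrf_eq0 (negbTE xa) orbF subr_eq0 => /eqP.
have kaE i : k i ^+ 2 = l^-1 -> a i \in E.
  by move=> ki; apply: lE; rewrite -[in RHS]kw ki mulVKf// lt0r_neq0.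
have aE i : (a i \in E) || (a i \in orthc E).
  have [//|aE] := boolP (a i \in E); apply/orthcP => x xE; apply/eqP.
  by apply: contraNT aE; rewrite innerC => /(kE i x xE)/kaE.
have zE : z \in E by apply: lE.
have E0 : E != 0%VS by apply: contraNneq z0 => E0; rewrite -memv0 -E0.
have Ef : E = fullv.
  apply/eqP; apply/negPn/negP => Ef; apply: irr; exists E, (orthc E); split=> //.
  - by apply: contra Ef => /eqP O0; rewrite -(add_orthc E) O0 addv0.
  - exact: directv_orthc.
  - exact: add_orthc.
pose mu := Num.sqrt l^-1; have mu2 : mu ^+ 2 = l^-1 by rewrite sqr_sqrtr ?invr_ge0 ?ltW.
exists (linfun (mulmxr (mu *: A))) => [x|i]; rewrite lfunE /= -scalemxAr.
  by rewrite sqnormZ El ?Ef ?memvf// mu2 mulKf// lt0r_neq0.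
have : k i ^+ 2 == mu ^+ 2.
  rewrite mu2 (kE i (a i)) ?Ef ?memvf//.
  by rewrite -/(sqnorm _) sqnorm_eq0.
by rewrite eqf_sqr bE => /orP[]/eqP ->; [left|right; rewrite scaleNr].
Qed.

End Uniqueness.

(** * Determinants of sums of rank-one matrices *)

Lemma fin_pos_lower_bound (R : realType) (I : finType) (P : pred I) (F : I -> R) :
  (forall i, P i -> 0 < F i) -> exists2 e, 0 < e & forall i, P i -> e <= F i.
Proof.
move=> F0; exists (\big[Num.min/1]_(i | P i) F i); first by apply: lt_bigmin.
by move=> i Pi; apply: bigmin_le_cond.
Qed.

Section RankOneUpdates.
Variables (R : realType) (d : nat).
Implicit Types (M N : 'M[R]_d) (u y : 'rV[R]_d).

(** The block matrix with rows (1, - q) and (p, 1) has a block triangular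
    factorization starting from either diagonal block. *)
Lemma det_1Dmul (p : 'cV[R]_d) (q : 'rV[R]_d) :
  \det (1%:M + p *m q) = 1 + (q *m p) 0 0.
Proof.
have e1 : block_mx 1%:M (- q) p 1%:M =
    block_mx 1%:M 0 p 1%:M *m block_mx 1%:M (- q) 0 (1%:M + p *m q).
  rewrite mulmx_block !mul1mx !mulmx1 !mulmx0 !mul0mx !addr0.
  by rewrite mulmxN addrC addrK.
have e2 : block_mx 1%:M (- q) p 1%:M =
    block_mx 1%:M (- q) 0 1%:M *m block_mx (1%:M + q *m p) 0 p 1%:M.
  rewrite mulmx_block !mul1mx !mulmx1 !mulmx0 !mul0mx !add0r.
  by rewrite mulNmx addrK.
have : \det (block_mx 1%:M (- q) p 1%:M) = \det (block_mx 1%:M (- q) p 1%:M) by [].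
rewrite {1}e1 e2 !det_mulmx !det_lblock !det_ublock !det1 !mul1r !mulr1 => ->.
by rewrite det_mx11 mxE mxE eqxx.
Qed.

Lemma det_rank1_update M u c : M \in unitmx ->
  \det (M + c *: (u^T *m u)) = \det M * (1 + c * inner (u *m invmx M) u).
Proof.
move=> Mu; have -> : M + c *: (u^T *m u) =
    M *m (1%:M + (c *: (invmx M *m u^T)) *m u).
  by rewrite mulmxDr mulmx1 -scalemxAl -scalemxAr !mulmxA mulmxV// mul1mx.
rewrite det_mulmx det_1Dmul; congr (_ * (_ + _)).
by rewrite -scalemxAr mxE /inner mulmxA.
Qed.

Lemma posdef_gram (B : 'M[R]_d) : B \in unitmx -> posdef (B^T *m B).
Proof.
move=> Bu; split=> [|y y0]; first by rewrite trmx_mul trmxK.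
have BTu : B^T \in unitmx by rewrite unitmx_tr.
rewrite mulmxA inner_mulmx -/(sqnorm _) sqnorm_gt0.
by apply: contra_neq y0 => yB; rewrite -(mulmxK BTu y) yB mul0mx.
Qed.

Lemma posdef_det_gt0 M : posdef M -> 0 < \det M.
Proof.
case/cholesky => C Cu ->; rewrite det_mulmx det_tr -expr2 exprn_even_gt0//=.
by rewrite -unitfE -unitmxE.
Qed.

Lemma posdef_unit M : posdef M -> M \in unitmx.
Proof. by move/posdef_det_gt0 => M0; rewrite unitmxE unitfE gt_eqF. Qed.

Lemma posdef_inv_ge0 M u : posdef M -> 0 <= inner (u *m invmx M) u.
Proof.
move=> pM; have Mu := posdef_unit pM; have [Ms Mp] := pM.
have [->|u0] := eqVneq u 0; first by rewrite mul0mx inner0l.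
rewrite -{2}(mulmxKV Mu u) innerC; apply/ltW/Mp.
by apply: contra_neq u0 => uM; rewrite -(mulmxKV Mu u) uM mul0mx.
Qed.

Lemma posdef_rank1_update M u c : posdef M -> 0 <= c ->
  posdef (M + c *: (u^T *m u)) /\ \det M <= \det (M + c *: (u^T *m u)).
Proof.
move=> pM c0; have [Ms Mp] := pM; split.
  split=> [|y y0].
    by rewrite linearD linearZ /= trmx_mul trmxK Ms.
  rewrite mulmxDr innerDl ltr_pwDl ?Mp// -scalemxAr innerZl mulr_ge0//.
  by rewrite mulmxA inner_mulmx -/(sqnorm _) sqnorm_ge0.
rewrite det_rank1_update ?posdef_unit// ler_peMr ?(ltW (posdef_det_gt0 pM))//.
by rewrite lerDl mulr_ge0// posdef_inv_ge0.
Qed.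

End RankOneUpdates.

(** * Coercivity of the potential *)

Section RadialIsotropic.
Variables (R : realType) (d n : nat).
Variables (v : 'I_n -> 'rV[R]_d) (w : 'I_n -> R).

Definition moment_mx (x : 'I_n -> R) : 'M[R]_d :=
  \sum_i x i *: ((v i)^T *m v i).

Lemma inner_moment_mx x y :
  inner (y *m moment_mx x) y = \sum_i x i * inner y (v i) ^+ 2.
Proof.
rewrite /moment_mx mulmx_sumr inner_suml; apply: eq_bigr => i _.
by rewrite -scalemxAr innerZl mulmxA inner_mulmx inner11.
Qed.

Definition pick_mx (f : 'I_d -> 'I_n) : 'M[R]_d := \matrix_k v (f k).

(** By the Cauchy-Binet formula the determinant is a sum of nonnegative terms,
    one of which is the left hand side.  Here it is obtained by adding the
    remaining rank-one matrices to the one built from [f]: each of them can only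
    increase the determinant of a positive definite matrix. *)
Lemma moment_mx_det_ge (x : 'I_n -> R) (f : 'I_d -> 'I_n) : (forall i, 0 < x i) ->
  injective f -> pick_mx f \in unitmx ->
  posdef (moment_mx x) /\
  (\prod_k x (f k)) * \det (pick_mx f) ^+ 2 <= \det (moment_mx x).
Proof.
move=> x0 fi fu.
(* [B^T *m B] is the part of the moment matrix indexed by [f]. *)
pose D : 'rV[R]_d := \row_k Num.sqrt (x (f k)).
pose B := diag_mx D *m pick_mx f.
have detB : \det B ^+ 2 = \prod_k x (f k) * \det (pick_mx f) ^+ 2.
  rewrite det_mulmx det_diag exprMn -prodrXl; congr (_ * _).
  by apply: eq_bigr => k _; rewrite mxE sqr_sqrtr// ltW.
have Bu : B \in unitmx.
  rewrite unitmx_mul fu andbT unitmxE det_diag unitfE; apply/prodf_neq0 => k _.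
  by rewrite mxE gt_eqF// sqrtr_gt0.
have BE k j : B k j = Num.sqrt (x (f k)) * v (f k) 0 j.
  by rewrite /B mul_diag_mx !mxE.
have BB : B^T *m B = \sum_k x (f k) *: ((v (f k))^T *m v (f k)).
  apply/matrixP => j l; rewrite mxE summxE; apply: eq_bigr => k _.
  rewrite mxE !BE mxE mxE big_ord1 mxE mulrACA -expr2 sqr_sqrtr//.
  exact: ltW.
pose im := [set f k | k in 'I_d].
have -> : moment_mx x = B^T *m B +
    \sum_(i <- enum (~: im)) x i *: ((v i)^T *m v i).
  rewrite /moment_mx (bigID (mem im)) /= BB big_imset/=; last by move=> k l _ _;
    apply: fi.
  rewrite big_enum_cond; congr (_ + _); apply: eq_bigl => i.
  by rewrite /= finset.in_setC andbT.
rewrite -[X in X <= _]detB; have : \det B ^+ 2 <= \det (B^T *m B).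
  by rewrite [leRHS]det_mulmx det_tr -expr2.
move: (posdef_gram Bu); move: (B^T *m B) => N pN BN.
elim: (enum _) N pN BN => [|i r IH] N pN BN; first by rewrite big_nil addr0.
rewrite big_cons addrA; have [pN' NN'] := posdef_rank1_update (v i) pN (ltW (x0 i)).
by apply: IH => //; apply: le_trans NN'.
Qed.

End RadialIsotropic.

Section Greedy.
Variables (R : realType) (d n : nat).
Variables (v : 'I_n -> 'rV[R]_d) (w : 'I_n -> R).

(** [PK_PK2] bounds the weight of a flat; in terms of normal vectors it is needed
    for arbitrary sets, because the initial segments met by the greedy
    construction need not be closed under taking spans. *)
Definition stable_weights :=
  [/\ forall i, v i != 0, forall i, 0 < w i, \sum_i w i = d%:R,
      (\sum_i <[v i]> = fullv)%VS
    & forall J : {set 'I_n}, (0 < #|J| < n)%N ->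
        \sum_(i in J) w i < (\dim (\sum_(i in J) <[v i]>)%VS)%:R].

Let rank s := \dim <<[seq v i | i <- s]>>.
Let weight s := \sum_(i <- s) w i.

(** The list i :: s is sorted by increasing t, and the basis is built from its
    end, keeping a vector whenever it is independent of those that come later.
    Let h be the head of s, and let r and W be the rank and the weight of s.
    Prepending i changes the right hand side by (1 - w_i) t_i or by - w_i t_i,
    according to whether the rank grows; so the induction step amounts to
    (r - W) t_h >= (r - W) t_i + e (t_h - t_i), which holds because
    r - W >= e. *)
Lemma greedy_basis (e : R) (t : 'I_n -> R) i s : 0 <= e ->
  (forall j, v j != 0) ->
  (forall s', s' != [::] -> uniq s' -> (size s' < n)%N ->
     e <= (rank s')%:R - weight s') ->
  uniq (i :: s) -> path (fun j k => t j <= t k) i s ->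
  exists g, [/\ free [seq v j | j <- g],
    <<[seq v j | j <- g]>>%VS = <<[seq v j | j <- i :: s]>>%VS &
    forall j, j \in i :: s ->
      ((rank (i :: s))%:R - weight (i :: s)) * t i + e * (t j - t i) <=
      \sum_(k <- g) t k - \sum_(k <- i :: s) w k * t k].
Proof.
move=> e0 v0 he; elim: s i => [|h s IH] i.
  move=> _ _; exists [:: i]; split=> //=.
    by rewrite free_cons span_nil memv0 v0 nil_free.
  move=> j; rewrite inE => /eqP ->.
  rewrite /rank /weight /= span_seq1 dim_vline v0 !big_seq1 subrr mulr0 addr0.
  by rewrite mulrBl mul1r.
move=> us /= /andP[tih ths]; have us' : uniq (h :: s) by case/andP: us.
have [g [gfree gspan gle]] := IH h us' ths.
have hsz : (size (h :: s) < n)%N.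
  by have := max_card (mem (i :: h :: s)); rewrite (card_uniqP us) card_ord.
have eW := he (h :: s) isT us' hsz.
have et := ler_wpM2r (_ : 0 <= t h - t i) eW; rewrite subr_ge0 in et.
have {et} := et tih; set r := _%:R - _ => et.
have step j : j \in i :: h :: s -> r * t i + e * (t j - t i) <=
      \sum_(k <- g) t k - \sum_(k <- h :: s) w k * t k.
  rewrite inE => /orP[/eqP ->|/gle]; last by apply: le_trans; rewrite -/r; lra.
  have := gle h; rewrite mem_head => /(_ isT); apply: le_trans; rewrite -/r.
  have := mulr_ge0 e0 (_ : 0 <= t h - t i); rewrite subr_ge0 => /(_ tih); lra.
have weightE : weight (i :: h :: s) = w i + weight (h :: s).
  by rewrite /weight big_cons.
have [vi|vi] := boolP (v i \in <<[seq v j | j <- h :: s]>>%VS).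
  have spanE : <<[seq v j | j <- i :: h :: s]>>%VS = <<[seq v j | j <- h :: s]>>%VS.
    by rewrite map_cons span_cons; apply/addv_idPr; rewrite -memvE.
  exists g; split=> // [|j /step]; first by rewrite gspan -spanE.
  rewrite weightE /rank spanE -/(rank _) [in X in _ -> X]big_cons /r; lra.
exists (i :: g); split=> [||j /step].
- by rewrite map_cons free_cons gspan vi gfree.
- by rewrite map_cons span_cons gspan -span_cons.
have rankE : rank (i :: h :: s) = (rank (h :: s)).+1.
  rewrite /rank map_cons span_cons dimv_disjoint_sum ?dim_vline ?v0//.
  apply/eqP; rewrite -subv0; apply/subvP => x; rewrite memv_cap memv0.
  case/andP => /vlineP[k ->]; apply: contraLR; rewrite scaler_eq0 (negbTE (v0 i)) orbF.
  by move=> k0; rewrite rpredZeq (negbTE k0).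
rewrite weightE rankE -natr1 !(big_cons _ _ i) /r; lra.
Qed.

Lemma span_set s : uniq s ->
  (<<[seq v i | i <- s]>> = \sum_(i in [set j | j \in s]) <[v i]>)%VS.
Proof.
move=> us; rewrite span_def big_map big_uniq//=.
by apply: eq_bigl => i; rewrite inE.
Qed.

(** There are finitely many sublists, so that the strict inequalities of
    stability hold with a uniform gap. *)
Lemma stable_gap : stable_weights -> exists2 e, 0 < e &
  forall s, s != [::] -> uniq s -> (size s < n)%N -> e <= (rank s)%:R - weight s.
Proof.
case=> _ _ _ _ wJ; have [|e e0 he] := @fin_pos_lower_bound R {set 'I_n}
    (fun J => 0 < #|J| < n)%N
    (fun J => (\dim (\sum_(i in J) <[v i]>)%VS)%:R - \sum_(i in J) w i).
  by move=> J hJ; rewrite subr_gt0 wJ.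
exists e => // s s0 us sn; have := he [set j | j \in s].
have -> : #|[set j | j \in s]| = size s by rewrite cardsE; apply/card_uniqP.
rewrite sn lt0n size_eq0 s0 /rank /weight => /(_ isT); rewrite span_set//.
rewrite big_uniq//=; congr (_ <= _ - _).
by apply: eq_bigl => i; rewrite inE.
Qed.

Lemma pick_mx_unit (g : seq 'I_n) (f : 'I_d -> 'I_n) :
  size g = d -> (forall k, nth (f k) g k = f k) ->
  free [seq v j | j <- g] -> pick_mx v f \in unitmx.
Proof.
move=> sg fg gfree; rewrite -row_free_unit; apply: inj_row_free => y.
have sz : size [seq v j | j <- g] == d by rewrite size_map sg.
rewrite /pick_mx row_combination => y0.
have /freeP h : free (Tuple sz) by [].
apply/rowP => k; rewrite mxE; apply: h; rewrite -[RHS]y0.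
by apply: eq_bigr => j _; rewrite (nth_map (f j)) ?sg// fg.
Qed.

(** Its logarithm is log det (sum_i e^(t_i) v_i^T v_i) - sum_i w_i t_i, a convex
    function that is constant along (1, ..., 1) when the w_i add up to d. *)
Definition potential (t : 'I_n -> R) :=
  \det (moment_mx v (fun i => expR (t i))) * expR (- \sum_i w i * t i).

(** For the full list of indices rank and weight are both d, and
    [greedy_basis] bounds the exponent of one term of the Cauchy-Binet formula
    by e times the oscillation of t. *)
Lemma potential_coercive : (0 < d)%N -> stable_weights ->
  exists c e, [/\ 0 < c, 0 < e & forall t,
    posdef (moment_mx v (fun i => expR (t i))) /\
    forall j k, c * expR (e * (t j - t k)) <= potential t].
Proof.
move=> d0 st; have [e e0 he] := stable_gap st; have [v0 w0 wd spanf _] := st.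
have [|c c0 hc] := @fin_pos_lower_bound R {ffun 'I_d -> 'I_n}
    (fun f => pick_mx v f \in unitmx) (fun f => \det (pick_mx v f) ^+ 2).
  by move=> f; rewrite unitmxE unitfE => f0; rewrite exprn_even_gt0.
exists c, e; split=> // t.
have tot : total (fun j k => t j <= t k) by move=> j k; apply: le_total.
have tr : transitive (fun j k => t j <= t k) by move=> j k l; apply: le_trans.
have := sort_sorted tot (enum 'I_n);
  have := mem_sort (fun j k => t j <= t k) (enum 'I_n).
have := sort_uniq (fun j k => t j <= t k) (enum 'I_n); rewrite enum_uniq.
case: (sort _ _) => [|i s] us ms.
  move: wd; rewrite big1 => [/esym/eqP|j]; first by rewrite pnatr_eq0 -leqn0 leqNgt d0.
  by have := ms j; rewrite mem_enum.
move=> /= ps; have {}ms j : j \in i :: s by rewrite ms mem_enum.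
have min_i j : t i <= t j.
  have := ms j; rewrite inE => /orP[/eqP ->//|js].
  by have /allP/(_ j js) := order_path_min tr ps.
have [g [gfree gspan gle]] := greedy_basis (ltW e0) v0 he us ps.
have sumE (F : 'I_n -> R) : \sum_(j <- i :: s) F j = \sum_j F j.
  by rewrite big_uniq//; apply: eq_bigl => j; rewrite ms.
have spanE : <<[seq v j | j <- i :: s]>>%VS = fullv.
  by rewrite span_set// -spanf; apply: eq_bigl => j; rewrite inE ms.
have dimf : \dim (fullv : {vspace 'rV[R]_d}) = d by rewrite dimvf /dim /= mul1n.
have {}gle j : e * (t j - t i) <= \sum_(k <- g) t k - \sum_k w k * t k.
  have := gle j (ms j); rewrite /rank /weight spanE dimf !sumE wd subrr mul0r.
  by rewrite add0r.
have sg : size g = d.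
  by have /eqP := gfree; rewrite gspan spanE dimf size_map.
pose f := [ffun k : 'I_d => nth i g k].
have fg k : nth (f k) g k = f k by rewrite ffunE; apply: set_nth_default; rewrite sg.
have fi : injective f.
  move=> k l; rewrite !ffunE => /eqP; rewrite nth_uniq ?sg//.
    by move=> /eqP; apply: val_inj.
  by apply: map_uniq (free_uniq gfree).
have fu := pick_mx_unit sg fg gfree.
have x0 (j : 'I_n) : 0 < expR (t j) := expR_gt0 _.
have [pM dM] := moment_mx_det_ge x0 fi fu; split=> // j k.
have sumf : \sum_k t (f k) = \sum_(k <- g) t k.
  rewrite (big_nth i) sg big_mkord; apply: eq_bigr => l _.
  by rewrite ffunE.
apply: le_trans (_ : expR (\sum_k t (f k)) * c * expR (- \sum_i w i * t i) <= _).
  rewrite mulrAC -expRD mulrC ler_pM2r// ler_expR sumf.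
  apply: le_trans (gle j); rewrite ler_pM2l// lerD2l lerN2.
  exact: min_i.
rewrite ler_pM2r ?expR_gt0//; apply: le_trans dM.
rewrite expR_sum ler_pM2l; first exact: hc.
by apply: prodr_gt0 => l _; apply: expR_gt0.
Qed.

End Greedy.

(** * Existence of the tight frame *)

(** Both sides of the inequality agree at s = 0, so their derivatives w and q at
    this point are equal. *)
Lemma expR_tangent (R : realType) (q w : R) : 0 <= w ->
  (forall s, expR (w * s) <= 1 + (expR s - 1) * q) -> q = w.
Proof.
move=> w0 h; have hs s : w * s <= (expR s - 1) * q.
  by have := le_trans (expR_ge1Dx (w * s)) (h s); lra.
have q0 : 0 <= q.
  have := hs 1; have : 1 <= expR 1 - 1 :> R by have := expR_ge1Dx (1 : R); lra.
  by move=> e1 we; nra.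
(* The inequality at s = r bounds q from below, and at s = - r from above. *)
have wq r : 0 < r < 1 -> w * (1 - r) <= q.
  move=> /andP[r0 r1]; have := hs r.
  have er : expR r * (1 - r) <= 1.
    have := expR_ge1Dx (- r); rewrite expRN => er.
    by rewrite -ler_pdivlMl ?expR_gt0// mulr1.
  move=> hr; rewrite -(ler_pM2l r0); nra.
have qw r : 0 < r -> q <= w * (1 + r).
  move=> r0; have := hs (- r); rewrite expRN.
  have er := expR_ge1Dx r; have ep := expR_gt0 r.
  have -> : (expR r)^-1 - 1 = - ((expR r - 1) / expR r) by field; rewrite gt_eqF.
  have : r / (1 + r) <= (expR r - 1) / expR r.
    rewrite ler_pdivrMr ?addr_gt0// mulrAC ler_pdivlMr//; nra.
  move=> k1 k2; rewrite -(ler_pM2l r0).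
  have : r / (1 + r) * q <= w * r by nra.
  rewrite mulrAC ler_pdivrMr ?addr_gt0//; lra.
apply/eqP; rewrite eq_le; apply/andP; split; apply/ler_addgt0Pr => e egt0.
  have r0 : 0 < e / (w + 1) by rewrite divr_gt0//; lra.
  apply: le_trans (qw _ r0) _; rewrite mulrDr mulr1 lerD2l mulrA ler_pdivrMr; nra.
pose r := Num.min (1 / 2) (e / (w + 1)).
have r0 : 0 < r by rewrite lt_min divr_gt0 ?divr_gt0//; lra.
have r1 : r <= 1 / 2 by rewrite ge_min lexx.
have : r <= e / (w + 1) by rewrite ge_min lexx orbT.
rewrite ler_pdivlMr; last lra.
move=> re; have : w * (1 - r) <= q by apply: wq; rewrite r0 /=; lra.
by nra.
Qed.

Section Minimum.
Variables (R : realType) (d n : nat).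
Variables (v : 'I_n -> 'rV[R]_d) (w : 'I_n -> R).
Hypothesis d0 : (0 < d)%N.
Hypothesis st : stable_weights v w.

Let G := potential v w.

Lemma potential_shift (t : 'I_n -> R) c : G (fun i => t i - c) = G t.
Proof.
have [_ _ wd _ _] := st; rewrite /G /potential.
have -> : moment_mx v (fun i => expR (t i - c)) =
    expR (- c) *: moment_mx v (fun i => expR (t i)).
  rewrite /moment_mx scaler_sumr; apply: eq_bigr => i _.
  by rewrite scalerA expRD mulrC.
rewrite detZ; have -> : \sum_i w i * (t i - c) = \sum_i w i * t i - d%:R * c.
  rewrite -wd mulr_suml -sumrB; apply: eq_bigr => i _; ring.
rewrite opprB expRD -expRM_natl mulrN.
by rewrite -mulrA mulrCA; congr (_ * _); rewrite mulrA -expRD addNr expR0 mul1r.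
Qed.

Lemma continuous_potential : continuous (fun x : 'rV[R]_n => G (fun i => x 0 i)).
Proof.
have cE (F : 'rV[R]_n -> R) : continuous F -> continuous (fun x => expR (F x)).
  by move=> cF x; apply: continuous_comp (cF x) _; apply: continuous_expR.
apply: continuous_mul.
  rewrite /determinant; apply: continuous_bigsum => s.
  apply: continuous_mul; first exact: cst_continuous.
  apply: continuous_bigprod => i.
  under eq_fun do rewrite summxE.
  apply: continuous_bigsum => j; under eq_fun do rewrite mxE.
  apply: continuous_mul; last exact: cst_continuous.
  by apply: cE; apply: coord_continuous.
apply: cE => x; apply: continuousN; move: x; apply: continuous_bigsum => i.
apply: continuous_mul; first exact: cst_continuous.
exact: coord_continuous.
Qed.

(** By coercivity the values below the one at 0 are attained, up to translation,
    in a box, where the potential has a minimum by compactness. *)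
Lemma potential_min : exists t, forall u, G t <= G u.
Proof.
have [c [e [c0 e0 hc]]] := potential_coercive d0 st.
have G0 : 0 < G (fun=> 0).
  by rewrite mulr_gt0 ?expR_gt0//; apply: posdef_det_gt0; have [] := hc (fun=> 0).
pose T := G (fun=> 0) / (c * e).
have T0 : 0 < T by rewrite divr_gt0// mulr_gt0.
have box0 : ([set x : 'rV[R]_n | forall i, - T <= x 0 i <= 0] !=set0)%classic.
  by exists 0 => i; rewrite mxE lexx andbT oppr_le0 ltW.
have [x xbox xmin] := EVT_min_rV box0 (@compact_box R n (- T) 0)
  (continuous_subspaceT continuous_potential).
exists (fun i => x 0 i) => u.
have [i0 hi0] : exists i0, forall i, u i <= u i0.
  have n0 : (0 < n)%N.
    have [_ _ wd _ _] := st; rewrite lt0n; apply/eqP => n0.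
    move: wd; rewrite big1 => [/esym/eqP|[i hi]]; last by have := hi; rewrite {1}n0.
    by rewrite pnatr_eq0 -leqn0 leqNgt d0.
  exists [arg max_(i > Ordinal n0) u i]%O => i.
  by case: arg_maxP => // j _ hj; apply: hj.
pose u' i := u i - u i0; rewrite -(potential_shift u (u i0)) -/u'.
have u'le i : u' i <= 0 by rewrite subr_le0.
(* Either the translate of [u] with maximum 0 is in the box, or it oscillates
   by more than [T]. *)
have [/forallP hT|] := boolP [forall i, - T <= u' i].
  have uE : u' = (fun i => (\row_i u' i) 0 i) by apply/funext => i; rewrite mxE.
  by rewrite uE; apply: xmin; apply/mem_set => i; rewrite mxE hT u'le.
rewrite negb_forall => /existsP[j]; rewrite -ltNge => hj.
have le1 : G (fun i => x 0 i) <= G (fun=> 0).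
  have -> : (fun=> 0) = (fun i : 'I_n => (0 : 'rV[R]_n) 0 i) by apply/funext => i;
    rewrite mxE.
  by apply: xmin; apply/mem_set => i; rewrite mxE lexx andbT oppr_le0 ltW.
apply: le_trans le1 _; apply: le_trans ((hc u').2 i0 j).
have ge1 := expR_ge1Dx (e * (u' i0 - u' j)); rewrite -(ler_pM2l c0) in ge1.
apply: le_trans ge1.
have -> : u' i0 = 0 by rewrite /u' subrr.
have -> : G (fun=> 0) = c * (e * T).
  by rewrite mulrA /T mulrC divfK// gt_eqF// mulr_gt0.
have : e * T < e * - u' j by rewrite ltr_pM2l//; lra.
by rewrite sub0r ler_pM2l//; lra.
Qed.

(** Moving t_i alone is a rank-one update of the moment matrix, so that the
    potential along this line is known in closed form and minimality reduces to
    [expR_tangent]. *)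
Lemma potential_critical (t : 'I_n -> R) : (forall u, G t <= G u) ->
  forall i, expR (t i) *
    inner (v i *m invmx (moment_mx v (fun i => expR (t i)))) (v i) = w i.
Proof.
move=> tmin i; have [c [e [_ _ hc]]] := potential_coercive d0 st.
have [pM _] := hc t; have [_ w0 _ _ _] := st.
set M := moment_mx _ _ in pM *; apply: expR_tangent; first exact: ltW.
move=> s; pose u j := t j + (if j == i then s else 0).
have MuE : moment_mx v (fun j => expR (u j)) =
    M + ((expR s - 1) * expR (t i)) *: ((v i)^T *m v i).
  rewrite /M /moment_mx (bigD1 i)//= [in RHS](bigD1 i)//= addrAC -scalerDl.
  congr (_ *: _ + _); first by rewrite /u eqxx expRD; ring.
  by apply: eq_bigr => j /negbTE ji; rewrite /u ji addr0.
have wuE : - \sum_j w j * u j = - \sum_j w j * t j - w i * s.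
  rewrite -opprD; congr (- _); rewrite (bigD1 i)//= [in RHS](bigD1 i)//=.
  rewrite /u eqxx mulrDr addrAC; congr (_ + _ + _).
  by apply: eq_bigr => j /negbTE ->; rewrite addr0.
have := tmin u; rewrite /G /potential MuE wuE -/M det_rank1_update ?posdef_unit//.
rewrite expRD mulrACA -[leLHS]mulr1 ler_pM2l; last first.
  by rewrite mulr_gt0 ?expR_gt0// posdef_det_gt0.
by rewrite [expR (- (w i * s))]expRN ler_pdivlMr ?expR_gt0// mul1r mulrA.
Qed.

(** If the moment matrix at the minimum is C0^T C0, then C = C0^-1 makes the
    frame tight, and the critical point equation says that its squared norms are
    the weights. *)
Lemma radial_isotropic : exists (C : 'M[R]_d) (r : 'I_n -> R),
  [/\ C \in unitmx, forall i, r i != 0, tight (fun i => r i *: (v i *m C))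
    & forall i, sqnorm (r i *: (v i *m C)) = w i].
Proof.
have [t tmin] := potential_min; have crit := potential_critical tmin.
have [c [e [_ _ hc]]] := potential_coercive d0 st.
have [pM _] := hc t; have [C Cu ME] := cholesky pM.
have CTu : C^T \in unitmx by rewrite unitmx_tr.
exists (invmx C), (fun i => Num.sqrt (expR (t i))); split.
- by rewrite unitmx_inv.
- by move=> i; rewrite gt_eqF// sqrtr_gt0 expR_gt0.
- move=> y; transitivity (\sum_i expR (t i) * inner (y *m invmx C^T) (v i) ^+ 2).
    apply: eq_bigr => i _; rewrite innerZr exprMn sqr_sqrtr ?expR_ge0//.
    by rewrite innerC inner_mulmx trmx_inv innerC.
  rewrite -inner_moment_mx ME mulmxA mulmxKV// inner_mulmx.
  by rewrite mulmxKV.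
move=> i; rewrite sqnormZ sqr_sqrtr ?expR_ge0// -crit; congr (_ * _).
rewrite ME /sqnorm inner_mulmx innerC; congr (inner _ _).
rewrite -mulmxA; congr (_ *m _).
apply: (can_inj (mulmxK (_ : C^T *m C \in unitmx))); rewrite ?unitmx_mul ?CTu//.
by rewrite mulVmx ?unitmx_mul ?CTu// trmx_inv mulmxA mulmxKV// mulVmx.
Qed.

End Minimum.

(** * The bijection *)

Section Realization.
Variables (R : realType) (d n : nat) (v : 'I_n -> 'rV[R]_d).
Hypothesis d0 : (0 < d)%N.
Hypothesis v0 : forall i, v i != 0.

(** For a set J of normals with span W, [PK_PK2] is applied to the flat
    orthogonal to W.  When this flat is 0, so that [PK_PK2] says nothing,
    dim W = d exceeds the weight of J because the other weights are
    positive. *)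
Lemma PK_stable_weights w :
  PK_arrangement (WArrangement (fun i => perp (v i)) w) -> stable_weights v w.
Proof.
case=> /= _ _ hw wd hJ _; have w0 i : 0 < w i by case/andP: (hw i).
pose W (J : {set 'I_n}) := (\sum_(i in J) <[v i]>)%VS.
have dimf : \dim (fullv : {vspace 'rV[R]_d}) = d by rewrite dimvf /dim /= mul1n.
have memW (J : {set 'I_n}) i : i \in J -> v i \in W J.
  by move=> iJ; rewrite memvE (sumv_sup i).
have lt_dimW (J : {set 'I_n}) : (0 < #|J|)%N -> orthc (W J) != 0%VS ->
    \sum_(i in J) w i < (\dim (W J))%:R.
  move=> /card_gt0P[i iJ] O0; have dO := dim_orthc (W J).
  have Of : orthc (W J) != fullv.
    apply: contraNneq (v0 i) => Of; rewrite -sqnorm_eq0 /sqnorm.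
    have /orthcP -> // : v i \in orthc (W J) by rewrite Of memvf.
    exact: memW.
  have := hJ J; rewrite inter_hyp_perp -/(W J) => /(_ O0 Of).
  rewrite -[X in X%:R - _]dO natrD addrK; apply: le_lt_trans.
  rewrite [leLHS]big_mkcond [leRHS]big_mkcond; apply: ler_sum => j _.
  case: ifPn => jJ; last by case: ifP => // _; apply: ltW.
  by rewrite sub_perp orthcK memW.
have n0 : (0 < n)%N.
  rewrite lt0n; apply/eqP => n0; move: wd; rewrite big1 => [/esym/eqP|[i hi]].
    by rewrite pnatr_eq0 -leqn0 leqNgt d0.
  by have := hi; rewrite {1}n0.
split=> //.
- have -> : (\sum_i <[v i]> = W [set: 'I_n])%VS.
    by apply: eq_bigl => i; rewrite finset.in_setT.
  have [O0|O0] := eqVneq (orthc (W [set: 'I_n])) 0%VS.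
    by rewrite -(add_orthc (W [set: 'I_n])) O0 addv0.
  have := lt_dimW [set: 'I_n]; rewrite cardsT card_ord => /(_ n0 O0).
  rewrite (eq_bigl xpredT) => [|i]; last by rewrite finset.in_setT.
  by rewrite wd ltr_nat ltnNge -[leqRHS]dimf dimvS ?subvf.
- move=> J /andP[J0 Jn].
  have [O0|O0] := eqVneq (orthc (W J)) 0%VS; last exact: lt_dimW.
  rewrite -/(W J); have -> : \dim (W J) = d by have := dim_orthc (W J);
    rewrite O0 dimv0 addn0.
  have /existsP[i iJ] : [exists i, i \notin J].
    rewrite -negb_forall; apply: contraTN Jn => /forallP hJn.
    by rewrite -leqNgt -[leqLHS]card_ord; apply/subset_leq_card/fintype.subsetP => i _.
  rewrite -wd [ltRHS](bigID (mem J)) /= ltrDl (bigD1 i)//=.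
  by rewrite ltr_pwDl// sumr_ge0// => j _; apply: ltW.
Qed.

Lemma scaled_image_lin_equiv (w r : 'I_n -> R) (C : 'M[R]_d) :
  C \in unitmx -> (forall i, r i != 0) ->
  (forall i, sqnorm (r i *: (v i *m C)) = w i) ->
  lin_equiv (arrangement_of (fun i => r i *: (v i *m C)))
            (WArrangement (fun i => perp (v i)) w).
Proof.
move=> Cu r0 sw; split=> //=; have CTu : C^T \in unitmx by rewrite unitmx_tr.
pose F := linfun (mulmxr C^T : 'rV[R]_d -> 'rV[R]_d).
have kF : lker F == 0%VS.
  by apply/lker0P => x y; rewrite !lfunE /= => /(can_inj (mulmxK CTu)).
exists F => // i.
have a0 : r i *: (v i *m C) != 0.
  rewrite scaler_eq0 (negbTE (r0 i)) /=; apply: contra_neq (v0 i) => vC.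
  by rewrite -(mulmxK Cu (v i)) vC mul0mx.
apply/esym/eqP; rewrite eqEdim; apply/andP; split.
  apply/subvP => _ /memv_imgP[x xa ->]; move: xa; rewrite !mem_perp lfunE /=.
  by rewrite innerZr mulf_eq0 (negbTE (r0 i)) inner_mulmx trmxK.
by rewrite (dim_limg kF) -(leq_add2r 1) !dim_perp.
Qed.

End Realization.

Lemma PK_realization (R : realType) (d n : nat) (X : warrangement R d n) :
  (2 <= d)%N -> PK_arrangement X ->
  exists2 a, irreducible_vee_system a & lin_equiv (arrangement_of a) X.
Proof.
move=> hd; case: X => H w PX.
have /choice[v hv] i : exists v, v != 0 /\ H i = perp v.
  by have [v v0 /= HE] := hyperplane_perp (PK_hyperplane PX i); exists v.
have {hv}[v0 HE] : (forall i, v i != 0) /\ H = fun i => perp (v i).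
  by split=> [i|]; [|apply/funext => i]; have [] := hv i.
have d0 : (0 < d)%N by apply: leq_trans hd.
rewrite {}HE in PX *.
have [C [r [Cu r0 ta sw]]] := radial_isotropic d0 (PK_stable_weights d0 v0 PX).
have eqX := scaled_image_lin_equiv v0 Cu r0 sw.
exists (fun i => r i *: (v i *m C)) => //; apply: PK_vee => //.
exact: PK_lin_equiv PX (lin_equiv_sym eqX).
Qed.

Theorem corollary1p3 (R : realType) (d n : nat) (hd : (2 <= d)%N) :
  let V := [set a : 'I_n -> 'rV[R]_d | irreducible_vee_system a]%classic in
  let K := [set X : warrangement R d n | PK_arrangement X]%classic in
  (forall a, V a -> K (arrangement_of a)) /\
  exists2 Phi : set ('I_n -> 'rV[R]_d) -> set (warrangement R d n),
    set_bij (eq_classes V (@orth_proj_equiv R d n))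
            (eq_classes K (@lin_equiv R d n)) Phi
    & forall a, V a ->
        Phi (eq_class V (@orth_proj_equiv R d n) a)
        = eq_class K (@lin_equiv R d n) (arrangement_of a).
Proof.
move=> V K; have VK a : V a -> K (arrangement_of a) by apply: vee_PK.
split=> //; apply: eq_classes_bij => //.
- exact: orth_proj_equiv_refl.
- exact: orth_proj_equiv_sym.
- exact: orth_proj_equiv_trans.
- exact: lin_equiv_refl.
- exact: lin_equiv_sym.
- exact: lin_equiv_trans.
- move=> a b [va irra] [vb _]; split; first exact: orth_proj_lin_equiv.
  have d0 : (0 < d)%N by apply: leq_trans hd.
  apply: tight_rigid => //; [exact: vee_neq0 va|exact: vee_V1 va|exact: vee_V1 vb].
- by move=> X KX; apply: PK_realization.
Qed.
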